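(* Let $V$ be a $\mathbb{C}$-vector space of dimension $n$ and let $u:V\to V$ be a nilpotent endomorphism whose Young diagram $Y=Y(u)$ has two columns of lengths $r\geq s$. Let $F_{\overline{T}}$ be the flag whose $i$-th subspace is $\langle e_1,\dots,e_i\rangle$ for every $i$, where $(e_1,\dots,e_n)$ is a fixed Jordan basis of $u$ ordered so that $u(e_i)=0$ for $i\leq r$ and $u(e_i)=e_{i-r}$ for $i\geq r+1$. (a) The flag $F_{\overline{T}}$ belongs to every irreducible component of $\mathcal{B}_u$. (b) An irreducible component $\mathcal{K}\subset\mathcal{B}_u$ is nonsingular if and only if $F_{\overline{T}}$ is a nonsingular point of $\mathcal{K}$.
   Context: $\mathcal{B}_u$ (the Springer fiber) is the projective variety of complete flags $F=(V_0\subset V_1\subset\dots\subset V_n=V)$, $\dim V_i=i$, with $u(V_i)\subset V_i$ for all $i$. Its irreducible components are considered as reduced varieties. $Y(u)$ is the Young diagram whose rows have lengths equal to the sizes (in weakly decreasing order) of the Jordan blocks of $u$. Here $Y=Y(u)$ has two columns of lengths $r\geq s\geq 1$, so $n=r+s$; equivalently $u^2=0$ and $\mathrm{rank}\,u=s\ge 1$. $\overline{T}$ denotes the tableau of shape $Y$ numbered from top to bottom by $1,\dots,r$ in the first column and by $r+1,\dots,n$ in the second column; $F_{\overline{T}}$ is the flag associated to it, as described in the claim. *)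

(* Defs.v *)
From mathcomp Require Import all_boot all_order all_algebra.
From mathcomp Require Import classical_sets.
From mathcomp Require Import mpoly.

Set Implicit Arguments.
Unset Strict Implicit.
Unset Printing Implicit Defensive.

Import GRing.Theory.
Local Open Scope classical_set_scope.
Local Open Scope ring_scope.

Section Affine.
Variables (C : closedFieldType) (N : nat).

Definition zero_locus (S : set {mpoly C[N]}) : set 'rV[C]_N :=
  [set x | forall f, S f -> f.@[x 0] = 0].

Definition affine_closed (X : set 'rV[C]_N) : Prop :=
  exists S : set {mpoly C[N]}, X = zero_locus S.

(* The ideal of all polynomials vanishing on X, so that X carries its reduced
   structure. *)
Definition vanishing_ideal (X : set 'rV[C]_N) : set {mpoly C[N]} :=
  [set f | forall x, X x -> f.@[x 0] = 0].

(* Zariski tangent space at x: the common kernel of the differentials at x of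
   the elements of the vanishing ideal. *)
Definition tangent (X : set 'rV[C]_N) (x : 'rV[C]_N) : set 'rV[C]_N :=
  [set v | forall f, vanishing_ideal X f ->
             \sum_(k < N) f^`M(k).@[x 0] * v 0 k = 0].

End Affine.

Section FlagVariety.
Variables (C : closedFieldType) (V : vectType C) (n : nat).

Definition preflag := {ffun 'I_n.+1 -> {vspace V}}.

Definition is_flag (F : preflag) : Prop :=
  [/\ forall i, \dim (F i) = i,
      forall i j : 'I_n.+1, (i <= j)%N -> (F i <= F j)%VS
    & F ord_max = fullv].

Definition flag_of (b : n.-tuple V) : preflag :=
  [ffun i : 'I_n.+1 => <<take i b>>%VS].

(* Positions (i, j) strictly below the diagonal: the coordinates of a big
   cell, whose dimension is n (n - 1) / 2. *)
Definition lowpos := {p : 'I_n * 'I_n | (p.2 < p.1)%N}.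
Definition cell_dim : nat := #|{: lowpos}|.

(* The basis b' with b'_j = b_j + \sum_(i > j) x_ij b_i. *)
Definition cell_basis (b : n.-tuple V) (x : 'rV[C]_cell_dim) : n.-tuple V :=
  [tuple tnth b j +
     \sum_(p : lowpos | (val p).2 == j)
        x 0 (enum_rank p) *: tnth b (val p).1 | j < n].

(* The structure of algebraic variety on the set of complete flags is the one
   given by the atlas of big cells: for every basis b of V, the map
   x |-> flag_of (cell_basis b x) identifies the affine space of dimension
   n (n - 1) / 2 with the open set of the flags that are in general position
   with respect to the flag of b read backwards. *)
Definition cell_trace (b : n.-tuple V) (Z : set preflag) :
    set 'rV[C]_cell_dim :=
  [set x | Z (flag_of (cell_basis b x))].

Definition zclosed (Z : set preflag) : Prop :=
  (forall F, Z F -> is_flag F) /\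
  (forall b : n.-tuple V, basis_of fullv b -> affine_closed (cell_trace b Z)).

Definition zirreducible (Z : set preflag) : Prop :=
  (exists F, Z F) /\
  (forall Z1 Z2, zclosed Z1 -> zclosed Z2 -> Z `<=` Z1 `|` Z2 ->
     Z `<=` Z1 \/ Z `<=` Z2).

Definition irreducible_component (X K : set preflag) : Prop :=
  [/\ zclosed K, zirreducible K, K `<=` X
    & forall K', zclosed K' -> zirreducible K' -> K' `<=` X ->
        K `<=` K' -> K' = K].

Definition irr_chain (X : set preflag) (d : nat) : Prop :=
  exists Z : nat -> set preflag,
    (forall i, (i <= d)%N -> [/\ zclosed (Z i), zirreducible (Z i) & Z i `<=` X])
    /\ (forall i, (i < d)%N -> Z i `<` Z i.+1).

(* "X has Krull dimension d", for a closed set X. *)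
Definition has_zdim (X : set preflag) (d : nat) : Prop :=
  irr_chain X d /\ (forall d', irr_chain X d' -> (d' <= d)%N).

(* For an irreducible closed K: the dimension of the tangent space at F equals
   the dimension of K.  The tangent space is computed in a big cell containing
   F; since the tangent space is intrinsic, its dimension does not depend on
   the cell. *)
Definition nonsingular_at (K : set preflag) (F : preflag) : Prop :=
  K F /\
  exists (b : n.-tuple V) (x : 'rV[C]_cell_dim) (T : {vspace 'rV[C]_cell_dim}),
    [/\ basis_of fullv b,
        F = flag_of (cell_basis b x),
        forall v, v \in T <-> tangent (cell_trace b K) x v
      & has_zdim K (\dim T)].

Definition nonsingular (K : set preflag) : Prop :=
  forall F, K F -> nonsingular_at K F.

Definition springer_fiber (u : 'End(V)) : set preflag :=
  [set F | is_flag F /\ forall i, (u @: F i <= F i)%VS].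

End FlagVariety.

Arguments springer_fiber {C V} n u.

Section JordanType.
Variables (C : closedFieldType) (V : vectType C).

Definition nilpotent_end (u : 'End(V)) : Prop :=
  exists k, forall v, iter k u v = 0.

(* lam lists the sizes of the Jordan blocks of the nilpotent map u in weakly
   decreasing order, i.e. the row lengths of its Young diagram; w i 0, w i 1,
   ... is the Jordan chain of the i-th block. *)
Definition young_diagram (u : 'End(V)) (lam : seq nat) : Prop :=
  [/\ sorted geq lam, 0%N \notin lam &
   exists w : nat -> nat -> V,
     [/\ basis_of fullv
           [seq w i j | i <- iota 0 (size lam), j <- iota 0 (nth 0%N lam i)],
         forall i, (i < size lam)%N -> u (w i 0%N) = 0
       & forall i j, (i < size lam)%N -> (j.+1 < nth 0%N lam i)%N ->
           u (w i j.+1) = w i j]].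

End JordanType.

Definition column_lengths (lam : seq nat) : seq nat :=
  [seq count (fun l => (j < l)%N) lam | j <- iota 0 (head 0%N lam)].

(* Main.v *)
(** The centralizer Z(u) is connected, so it stabilizes every component K.  On
    the other hand every flag degenerates to F_T under Z(u): column by column,
    multiplying by t + A with A a matrix unit (or a pair of them) commuting with
    u, and letting t tend to 0, moves the k-th step of the flag onto
    <e_1, ..., e_k>.  Hence every nonempty closed Z(u)-stable set of flags
    contains F_T, which gives (a).  For (b), the points of K where the tangent
    dimension is at most dim T_(F_T) K = dim K contain a neighbourhood of F_T,
    so every Z(u)-orbit in K meets it.  Conversely a tangent space has dimension
    at least dim K: along a chain of primes I_0 > ... > I_d choose f_i in
    I_(i-1) \ I_i; the f_i are algebraically independent modulo I_d, and in
    characteristic 0 the d derivations d/df_i extend to the function field, where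
    they give d independent tangent vectors at a generic point. *)

From HB Require Import structures.
Require Import Defs.
From mathcomp Require Import all_boot all_order all_algebra.
From mathcomp Require Import classical_sets reals boolp.
From mathcomp Require Import complex.
From mathcomp Require Import mpoly ring zify.

Import GRing.Theory.
Local Open Scope ring_scope.

Set Implicit Arguments.
Unset Strict Implicit.
Unset Printing Implicit Defensive.

(** * Extension of derivations *)

(** Dimension is defined by chains of closed sets of flags, whereas the tangent bound is affine. A
    chain keeps its length inside a big cell only when the cell meets its smallest member, and that
    member may lie far from the point under study. Stability of [K] repairs this: translating a cell
    by Z(u) changes the flags it contains but not the trace of [K] in coordinates, so tangent spaces
    may be read in whichever translate is convenient. The same remark transports smoothness along
    Z(u)-orbits. The tangent bound works with polynomials modulo a prime ideal: elements outside the
    ideal serve as denominators, and a derivation is a morphism to [A[T]] read modulo T^2, rescaled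
    whenever a denominator appears. In the degenerations [t + A] is usually singular at t = 0, so
    the limit flag has to be found by dividing relations between columns by t. The inequality r >= s
    enters as n <= 2r: it makes u^2 = 0, which is what lets so few matrix units commute with u. *)

Lemma mpoly_ring_ind (R : comNzRingType) (N : nat) (K : {mpoly R[N]} -> Prop) :
    (forall c, K c%:MP) -> (forall k, K 'X_k) ->
    (forall f g, K f -> K g -> K (f + g)) ->
    (forall f g, K f -> K g -> K (f * g)) ->
  forall f, K f.
Proof.
move=> KC KX KD KM f; elim/mpolyind: f => [|c m f _ _ Kf].
  by rewrite -mpolyC0; apply: KC.
apply: (KD) => //; rewrite -mul_mpolyC; apply: (KM) => //.
rewrite mpolyXE_id; elim/big_ind: _ => [|p q|k _].
- by rewrite -mpolyC1; apply: KC.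
- exact: (KM).
- elim: (m k) => [|l IHl]; first by rewrite expr0 -mpolyC1; apply: KC.
  by rewrite exprS; apply: KM.
Qed.

Section Derivations.
Variables (A : comNzRingType) (I : A -> Prop).

(** The domain [A / I] and its fraction field are never formed: congruences modulo [I] replace
    equalities, and elements outside [I] replace units. *)
Record prime_ideal : Prop := PrimeIdeal {
  pid0 : I 0;
  pidD : forall a b, I a -> I b -> I (a + b);
  pidM : forall a b, I b -> I (a * b);
  pid1 : ~ I 1;
  pid_prime : forall a b, I (a * b) -> I a \/ I b }.

Hypothesis Ip : prime_ideal.

Lemma pidB a b : I a -> I b -> I (a - b).
Proof. by move=> Ia Ib; rewrite -mulN1r; apply: pidD => //; apply: pidM. Qed.

Lemma pid_subr a b : I (a - b) -> I b -> I a.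
Proof. by move=> Iab Ib; rewrite -(subrK b a); apply: pidD. Qed.

Lemma pid_cancel a b : ~ I a -> I (a * b) -> I b.
Proof. by move=> nIa /(pid_prime Ip) []. Qed.

Lemma pid_expn a k : ~ I a -> ~ I (a ^+ k).
Proof.
move=> nIa; elim: k => [|k IHk]; first by rewrite expr0; apply: pid1.
by rewrite exprS => /(pid_cancel nIa).
Qed.

Lemma pid_prod (T : finType) (F : T -> A) :
  (forall i, ~ I (F i)) -> ~ I (\prod_i F i).
Proof.
move=> nIF; elim/big_ind: _ => [|x y nx ny /(pid_cancel nx)//|i _]; last exact: nIF.
exact: pid1.
Qed.

(** The kernel of [A[T] -> (A/I)[T]/(T^2)]. *)
Definition jet_ideal (q : {poly A}) := I q`_0 /\ I q`_1.

Lemma coef1M (p q : {poly A}) : (p * q)`_1 = p`_0 * q`_1 + p`_1 * q`_0.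
Proof. by rewrite coefM big_ord_recl big_ord1. Qed.

Lemma jet_idealM p q : jet_ideal q -> jet_ideal (p * q).
Proof.
move=> [I0 I1]; split; first by rewrite coef0M; apply: pidM.
by rewrite coef1M; apply: pidD => //; apply: pidM.
Qed.

Lemma jet_idealD p q : jet_ideal p -> jet_ideal q -> jet_ideal (p + q).
Proof. by move=> [? ?] [? ?]; split; rewrite coefD; apply: pidD. Qed.

Lemma jet_ideal_sum m (F : 'I_m -> {poly A}) :
  (forall i, jet_ideal (F i)) -> jet_ideal (\sum_i F i).
Proof.
move=> JF; elim/big_ind: _ => //; last exact: jet_idealD.
by split; rewrite coef0; apply: pid0.
Qed.

(* A ring morphism D : P -> A[T] is read modulo T^2: its constant coefficient is
   a morphism ev : P -> A and its coefficient of T an ev-derivation, which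
   induces a derivation on P / ev^-1(I) exactly when D is liftable. *)
Definition liftable (P : comNzRingType) (D : P -> {poly A}) :=
  forall p, I (D p)`_0 -> I (D p)`_1.

Section Extend.
Hypothesis char0 : forall m, ~ I m.+1%:R.
Variables (P : comNzRingType) (D : {rmorphism P -> {poly A}}).
Hypothesis Dlift : liftable D.

(** Substituting [s T] for [T] keeps the evaluation and multiplies the derivation by [s]; this is
    how denominators are cleared. *)
Definition dilate (s : A) : {rmorphism P -> {poly A}} :=
  (comp_poly (s *: 'X) \o D).

Lemma coef0_dilate s p : (dilate s p)`_0 = (D p)`_0.
Proof.
by rewrite /= -!horner_coef0 horner_comp hornerZ hornerX mulr0.
Qed.

Lemma coef1_dilate s p : (dilate s p)`_1 = s * (D p)`_1.
Proof.
rewrite /= comp_polyE coef_sum.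
under eq_bigr => i _ do rewrite exprZn !coefZ coefXn.
have [lt1|le1] := ltnP 1 (size (D p)); last first.
  rewrite (nth_default _ le1) mulr0 big1 // => -[i /= Hi] _.
  by case: i Hi => [|i] Hi /=; rewrite ?mulr0 //; move: (leq_trans Hi le1).
rewrite (bigD1 (Ordinal lt1)) //= expr1 mulr1 mulrC big1 ?addr0 // => i ni.
rewrite eq_sym -[1%N]/(val (Ordinal lt1)) val_eqE (negbTE ni).
by rewrite !mulr0.
Qed.

Lemma dilate_liftable s : liftable (dilate s).
Proof.
by move=> p; rewrite coef0_dilate coef1_dilate => /Dlift; apply: pidM.
Qed.

Lemma commr_poly_rmorph (E : {rmorphism P -> {poly A}}) z : commr_rmorph E z.
Proof. by move=> p; rewrite /GRing.comm mulrC. Qed.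

Definition extend (E : {rmorphism P -> {poly A}}) z : {rmorphism {poly P} -> {poly A}} :=
  horner_morph (commr_poly_rmorph E z).

Lemma extendC E z p : extend E z p%:P = E p.
Proof. exact: horner_morphC. Qed.

Lemma extendX E z : extend E z 'X = z.
Proof. exact: horner_morphX. Qed.

Lemma extendE E z (p : {poly P}) :
  extend E z p = \sum_(i < size p) E p`_i * z ^+ i.
Proof.
rewrite {1}(_ : p = \sum_(i < size p) (p`_i)%:P * 'X^i); last first.
  by rewrite -[LHS]coefK poly_def; apply: eq_bigr => i _; rewrite mul_polyC.
rewrite rmorph_sum /=; apply: eq_bigr => i _.
by rewrite !rmorphM !rmorphXn /= extendC extendX.
Qed.

(** First-order Taylor expansion in the new variable: [extend E x%:P] differentiates the
    coefficients only, and the correction is [y] times the derivative in the variable. *)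
Lemma extend_taylor E (x y : A) (p : {poly P}) :
  (extend E (x%:P + y *: 'X) p)`_0 = (extend E x%:P p)`_0 /\
  (extend E (x%:P + y *: 'X) p)`_1 =
    (extend E x%:P p)`_1 + (extend E x%:P p^`())`_0 * y.
Proof.
elim/poly_ind: p => [|p c [IH0 IH1]].
  by rewrite deriv0 !rmorph0 !coef0 mul0r addr0.
rewrite derivD derivC addr0 derivM derivX mulr1 !rmorphD !rmorphM /=.
rewrite !extendC !extendX !coefD !coef0M !coef1M IH0 IH1.
rewrite !coefD !coefZ !coefX !coefC /= ?mulr0 ?mulr1 ?addr0 ?add0r; split=> //.
ring.
Qed.

Lemma extend_coefs (E : {rmorphism P -> {poly A}}) z (p : {poly P}) : liftable E ->
  (forall i, I (E p`_i)`_0) -> jet_ideal (extend E z p).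
Proof.
move=> lE Ip0; rewrite extendE; apply: jet_ideal_sum => // i.
by rewrite mulrC; apply: jet_idealM; split=> //; apply: lE.
Qed.

(* The new variable is either transcendental modulo I over the old ones, and
   its derivative may be chosen freely, or it is a root of a polynomial g of
   minimal degree, and its derivative is forced by g = 0 up to the denominator
   s = g'(xi). *)
Lemma extend_liftable (xi : A) :
  exists (s : A) (E : {rmorphism {poly P} -> {poly A}}),
    [/\ ~ I s, liftable E,
        forall p, (E p%:P)`_0 = (D p)`_0 /\ (E p%:P)`_1 = s * (D p)`_1
      & (E 'X)`_0 = xi].
Proof.
pose ev p := (extend D xi%:P p)`_0.
have ev_dil s y p : (extend (dilate s) (xi%:P + y *: 'X) p)`_0 = ev p.
  rewrite (extend_taylor (dilate s) xi y p).1 !extendE /ev extendE !coef_sum.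
  by apply: eq_bigr => i _; rewrite !coef0M coef0_dilate.
have evX s y : (extend (dilate s) (xi%:P + y *: 'X) 'X)`_0 = xi.
  by rewrite ev_dil /ev extendX coefC.
have evD p q : ev (p + q) = ev p + ev q by rewrite /ev rmorphD coefD.
have evM p q : ev (p * q) = ev p * ev q by rewrite /ev rmorphM coef0M.
have evC p : ev p%:P = (D p)`_0 by rewrite /ev extendC.
(* A witness is a relation for [xi] that is nontrivial modulo [I]; one of least size plays the role
   of the minimal polynomial of [xi]. *)
pose witness m := exists p : {poly P},
  [/\ size p = m, I (ev p) & ~ I (D (lead_coef p))`_0].
(* If [p] vanishes at [xi] and is too small to be a witness, its leading coefficient lies in [I];
   the leading term can be removed and the argument repeated. The disjunction serves both the
   transcendental and the algebraic case. *)
have no_witness m : (forall k, (k < m)%N -> ~ witness k) ->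
    forall p : {poly P}, (size p <= m)%N -> (size p < m)%N \/ ~ witness m ->
      I (ev p) -> forall i, I (D p`_i)`_0.
  move=> Hm p; elim/ltn_ind: {p}(size p) {-2}p (erefl (size p)) => l IHl p sp.
  rewrite sp => le_l lt_l Ievp.
  have Ilc : I (D (lead_coef p))`_0.
    apply: contrapT => nI; case: lt_l => [lt_l|nW].
      by apply: (Hm _ lt_l); exists p.
    have [lt_lm|] := ltnP l m; first by apply: (Hm _ lt_lm); exists p.
    move=> le_ml; apply: nW; exists p; split=> //; rewrite sp.
    by apply/eqP; rewrite eqn_leq le_l le_ml.
  have [p0|pn0] := eqVneq p 0; first by move=> i; rewrite p0 coef0 rmorph0 coef0; apply: pid0.
  pose q := p - lead_coef p *: 'X^(l.-1).
  have l_gt0 : (0 < l)%N by rewrite -sp size_poly_gt0.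
  have szq : (size q < l)%N.
    rewrite -[l in (_ < l)%N]prednK // ltnS; apply/leq_sizeP => j.
    rewrite leq_eqVlt => /predU1P[<-|lt_j]; rewrite coefB coefZ coefXn.
      by rewrite eqxx mulr1 lead_coefE sp subrr.
    rewrite gtn_eqF // mulr0 subr0 nth_default // sp.
    by rewrite -(prednK l_gt0).
  have Ievq : I (ev q).
    rewrite /q evD -scaleNr -mul_polyC evM evC rmorphN coefN mulrC mulrN -mulNr.
    by apply: pidD => //; apply: pidM.
  have IHq := IHl _ szq q erefl (leq_trans (ltnW szq) le_l) (or_introl (leq_trans szq le_l)) Ievq.
  move=> i; rewrite -(subrK (lead_coef p *: 'X^(l.-1)) p) -/q coefD rmorphD coefD.
  apply: pidD => //; rewrite coefZ rmorphM coef0M mulrC.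
  exact: pidM.
case: (pselect (exists m, witness m)) => [exw|now]; last first.
  (* Transcendental case: the derivative of [xi] is chosen to be 0. *)
  exists 1, (extend (dilate 1) (xi%:P + 0 *: 'X)); split=> //.
  - exact: pid1.
  - move=> p; rewrite ev_dil => Iev.
    have Ic : forall i, I (D p`_i)`_0.
      apply: (no_witness (size p)) => //; first by move=> k _ wk; apply: now; exists k.
      by right=> wk; apply: now; exists (size p).
    have [||_ //] := @extend_coefs (dilate 1) (xi%:P + 0 *: 'X) p.
    - exact: dilate_liftable.
    - by move=> i; rewrite coef0_dilate.
  - by move=> p; rewrite extendC coef0_dilate coef1_dilate.
have [m [wm minm]] : exists m, witness m /\ forall k, (k < m)%N -> ~ witness k.
  have exb : exists m, `[< witness m >] by case: exw => m ?; exists m; apply/asboolP.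
  case: (ex_minnP exb) => m /asboolP wm Hm; exists m; split=> // k lt_k wk.
  by have := Hm k (asboolT wk); rewrite leqNgt lt_k.
have [g [sg Ig nIlc]] := wm.
have m_gt1 : (1 < m)%N.
  rewrite ltnNge -sg; apply/negP => /size1_polyC gc.
  by apply: nIlc; rewrite gc lead_coefC -evC -gc.
pose s := ev g^`().
have [m' mE] : exists m', m = m'.+2 by case: (m) m_gt1 => [|[|m']] // _; exists m'.
have lcg' : (D g^`()`_m')`_0 = m'.+1%:R * (D (lead_coef g))`_0.
  by rewrite coef_deriv lead_coefE sg mE rmorphMn coefMn mulr_natl.
have nIlcg' : ~ I (D g^`()`_m')`_0.
  by rewrite lcg' => /(pid_cancel (@char0 m')).
have szg' : (size g^`() < m)%N by rewrite -sg lt_size_deriv // -size_poly_gt0 sg ltnW.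
(* Separability: in characteristic 0 the top coefficient of [g'] is outside [I], so [g'(xi)] in [I]
   would contradict the minimality of [g]. *)
have nIs : ~ I s.
  by move=> Is; apply: nIlcg'; apply: (no_witness m) => //; [apply: ltnW | left].
(* Differentiating [g(xi) = 0] forces [g'(xi) xi' = - (D g)(xi)]; after dilation by [s = g'(xi)] the
   value required at [xi] is [- (D g)(xi)], free of denominators. *)
pose E := extend (dilate s) (xi%:P - (extend D xi%:P g)`_1 *: 'X).
have EE : E = extend (dilate s) (xi%:P + (- (extend D xi%:P g)`_1) *: 'X).
  by rewrite /E scaleNr.
have dilx t p : (extend (dilate t) xi%:P p)`_1 = t * (extend D xi%:P p)`_1.
  rewrite !extendE !coef_sum mulr_sumr; apply: eq_bigr => i _.
  by rewrite !coef1M coef0_dilate coef1_dilate mulrDr -rmorphXn !coefC /= !mulr0 !add0r mulrA.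
have Jg : jet_ideal (E g).
  rewrite EE; split; first by rewrite ev_dil.
  have ev0 p : (extend (dilate s) xi%:P p)`_0 = ev p.
    by have := ev_dil s 0 p; rewrite scale0r addr0.
  by rewrite (extend_taylor _ _ _ _).2 dilx ev0 mulrN subrr; apply: pid0.
exists s, E; split=> //.
- move=> f; rewrite EE ev_dil -EE => If.
  (* Pseudo-division by [g]: the remainder is smaller than [g] and vanishes at [xi], so its
     coefficients lie in [I]. The power of the leading coefficient is outside [I] and cancels. *)
  have := Pdiv.ComRing.rdivp_eq g f; set k := Pdiv.Ring.rscalp f g.
  set q := Pdiv.Ring.rdivp f g; set r := Pdiv.Ring.rmodp f g => Ef.
  have gn0 : g != 0 by rewrite -size_poly_gt0 sg ltnW.
  have szr : (size r < m)%N by rewrite -sg Pdiv.Ring.ltn_rmodp.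
  have Ir : I (ev r).
    apply: (@pid_subr _ (- (ev q * ev g))); last first.
      by rewrite -mulNr; apply: pidM.
    rewrite opprK addrC -evM -evD -Ef -mul_polyC evM; exact: pidM.
  have Jr : jet_ideal (E r).
    apply: extend_coefs => //; first exact: dilate_liftable.
    move=> i; rewrite coef0_dilate; apply: (no_witness m) => //; first exact: ltnW.
    by left.
  have : jet_ideal (E (lead_coef g ^+ k *: f)).
    by rewrite Ef rmorphD rmorphM; apply: jet_idealD => //; apply: jet_idealM.
  rewrite -mul_polyC rmorphM {1}/E extendC rmorphXn => -[_].
  have If0 : I (E f)`_0 by rewrite EE ev_dil.
  rewrite coef1M => H.
  have := pidB H (pidM Ip ((dilate s (lead_coef g) ^+ k)`_1) If0); rewrite addrK; apply: pid_cancel.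
  rewrite -horner_coef0 horner_exp horner_coef0 coef0_dilate.
  exact: pid_expn.
- by move=> p; rewrite /E extendC coef0_dilate coef1_dilate.
- by rewrite /E -scaleNr evX.
Qed.

End Extend.
End Derivations.

(** * Iterated extensions, and algebraic independence along a chain of primes *)

Section Iterate.
Variables (A : comNzRingType) (I : A -> Prop).
Hypotheses (Ip : prime_ideal I) (char0 : forall m, ~ I m.+1%:R).

(** [Q] is an iterated polynomial ring over [P], one variable per element of [xs]; the denominators
    met on the way multiply up to [s]. *)
Lemma extend_liftable_seq (xs : seq A) (P : comNzRingType)
    (D : {rmorphism P -> {poly A}}) : liftable I D ->
  exists (s : A) (Q : comNzRingType) (i : {rmorphism P -> Q})
         (X : nat -> Q) (E : {rmorphism Q -> {poly A}}),
    [/\ ~ I s, liftable I E,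
        forall p, (E (i p))`_0 = (D p)`_0 /\ (E (i p))`_1 = s * (D p)`_1
      & forall k, (k < size xs)%N -> (E (X k))`_0 = xs`_k].
Proof.
elim: xs P D => [|x xs IHxs] P D Dl.
  exists 1, P, idfun, (fun=> 0), D; split=> //; first exact: pid1.
  by move=> p /=; rewrite mul1r.
have [s [E [nIs El E01 EX]]] := extend_liftable Ip char0 Dl x.
have [s' [Q [i [X [E' [nIs' El' E01' EX']]]]]] := IHxs _ E El.
exists (s' * s), Q, (i \o polyC), (fun k => if k is k'.+1 then X k' else i 'X), E'.
split=> //; first by move/(pid_cancel Ip nIs').
  move=> p /=; have [-> ->] := E01' p%:P; have [-> ->] := E01 p.
  by rewrite mulrA.
by case=> [|k] /=; [rewrite (E01' 'X).1 EX | move/EX'].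
Qed.

(* d elements of A, algebraically independent over C modulo I: they are the
   images under ev of the variables y of the polynomial ring P, and D i stands
   for the partial derivative with respect to y i. *)
Definition alg_independent (C : fieldType) (a : {rmorphism C -> A}) (d : nat) :=
  exists (P : comNzRingType) (h : {rmorphism C -> P}) (ev : {rmorphism P -> A})
         (y : nat -> P) (D : nat -> {rmorphism P -> {poly A}}),
    [/\ forall i p, (D i p)`_0 = ev p,
        forall i j, (i < d)%N -> (j < d)%N -> (D i (y j))`_1 = (i == j)%:R,
        forall i c, D i (h c) = (a c)%:P
      & forall p, I (ev p) -> p = 0].

End Iterate.

(** Let [x] be in [I d] but not in [I d.+1]. In a relation for [x] modulo [I d.+1], powers of the
    variable cancel because [x] is outside that prime, so the constant term may be taken nonzero.
    Modulo [I d], where [x] vanishes, only this constant term survives, and the induction hypothesis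
    makes it zero. *)
Lemma prime_chain_alg_independent (A : comNzRingType) (C : fieldType)
    (a : {rmorphism C -> A}) (I : nat -> A -> Prop) (d : nat) :
    (forall i, (i <= d)%N -> prime_ideal (I i)) ->
    (forall i x, (i < d)%N -> I i.+1 x -> I i x) ->
    (forall i, (i < d)%N -> exists2 x, I i x & ~ I i.+1 x) ->
  alg_independent (I d) a d.
Proof.
elim: d => [|d IHd] Ip Isub Iproper.
  exists C, idfun, a, (fun=> 0), (fun=> polyC \o a); split=> //.
    by move=> i p; rewrite /= coefC.
  move=> p Iap; apply/eqP; apply/negPn/negP => pn0.
  apply: (pid1 (Ip 0%N isT)).
  by rewrite -(rmorph1 a) -(mulVf pn0) rmorphM; apply: pidM => //; apply: Ip.
have [//|||P [h [ev [y [D [D0 D1 Dh Iev]]]]]] := IHd.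
- by move=> i le_id; apply: Ip; apply: leqW.
- by move=> i x lt_id; apply: Isub; apply: ltnW.
- by move=> i lt_id; apply: Iproper; apply: ltnW.
have [x Ix nIx] := Iproper d (ltnSn d).
have cp (E : {rmorphism P -> A}) z : commr_rmorph E z.
  by move=> p; rewrite /GRing.comm mulrC.
pose ev' : {rmorphism {poly P} -> A} := horner_morph (cp ev x).
(* The old partial derivatives kill the new variable; the last one is differentiation in that
   variable, trivial on [P]. *)
pose D' i : {rmorphism {poly P} -> {poly A}} :=
  if (i < d)%N then extend (D i) x%:P else extend (polyC \o ev) (x%:P + 'X).
exists {poly P}, (polyC \o h), ev'.
exists (fun j => if (j < d)%N then (y j)%:P else 'X), D'; split.
- move=> i p; have evE (E : {rmorphism P -> {poly A}}) (z : {poly A}) :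
    (forall q, (E q)`_0 = ev q) -> z`_0 = x -> (extend E z p)`_0 = ev' p.
    move=> E0 z0; elim/poly_ind: p => [|p c IHp].
      by rewrite !rmorph0 coef0.
    rewrite !rmorphD !rmorphM /= extendC extendX coefD coef0M IHp z0 E0.
    by rewrite /ev' /= horner_morphX horner_morphC.
  rewrite /D'; case: ifP => _; apply: evE => //.
  + by rewrite coefC.
  + by move=> q; rewrite /= coefC.
  + by rewrite coefD coefC coefX addr0.
- move=> i j; rewrite !ltnS /D' => le_id le_jd.
  case: ltnP => [lt_id|ge_id]; case: ltnP => [lt_jd|ge_jd].
  + by rewrite extendC D1.
  + by rewrite extendX coefC /= ltn_eqF // (leq_trans lt_id).
  + by rewrite extendC /= coefC /= gtn_eqF // (leq_trans lt_jd).
  + rewrite extendX coefD coefC coefX add0r /=.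
    have -> : i = d by apply/eqP; rewrite eqn_leq le_id.
    by rewrite (_ : j = d) ?eqxx //; apply/eqP; rewrite eqn_leq le_jd.
- move=> i c; rewrite /D'; case: ifP => _; first by rewrite /= extendC Dh.
  rewrite /= extendC /= -[ev _](D0 0%N) Dh coefC //.
move=> p Ip0; apply/eqP; apply/negPn/negP => pn0.
have Ipd1 := Ip d.+1 (leqnn _); have Ipd := Ip d (leqW (leqnn _)).
have [m [q nrq pE]] := multiplicity_XsubC p 0.
rewrite pn0 /= in nrq; rewrite subr0 in pE.
have Iq : I d.+1 (ev' q).
  move: Ip0; rewrite pE rmorphM rmorphXn /= [ev' 'X]horner_morphX mulrC.
  apply: pid_cancel => //; exact: pid_expn.
suff : q`_0 = 0 by move=> q0; move: nrq; rewrite /root horner_coef0 q0 eqxx.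
apply: Iev; have := Isub _ _ (ltnSn d) Iq.
have [q' [c qE]] : exists q' c, q = q' * 'X + c%:P.
  by elim/poly_ind: q {nrq pE Iq} => [|q' c _]; [exists 0, 0 | exists q', c];
     rewrite ?mul0r ?add0r.
rewrite {1}qE rmorphD rmorphM /= [ev' 'X]horner_morphX [ev' _%:P]horner_morphC.
rewrite qE coefD coefMX coefC add0r /= => H.
rewrite -[ev c](addKr (ev' q' * x)) addrC.
by apply: pidB => //; apply: pidM.
Qed.

(** * Tangent vectors from algebraically independent elements *)

Section TangentBound.
Variables (C : fieldType) (N : nat).
Local Notation A := {mpoly C[N]}.

Lemma mpoly_jet (E : {rmorphism A -> {poly A}}) :
    (forall c, (E c%:MP)`_0 = c%:MP /\ (E c%:MP)`_1 = 0) -> (forall k, (E 'X_k)`_0 = 'X_k) ->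
  forall f, (E f)`_0 = f /\ (E f)`_1 = \sum_(k < N) f^`M(k) * (E 'X_k)`_1.
Proof.
move=> Ec EX.
pose S (f : A) := (E f)`_0 = f /\ (E f)`_1 = \sum_(k < N) f^`M(k) * (E 'X_k)`_1.
have SC c : S c%:MP.
  rewrite /S (Ec c).1 (Ec c).2; split=> //=; rewrite big1 // => k _.
  by rewrite mderivC mul0r.
have SD f g : S f -> S g -> S (f + g).
  move=> [f0 f1] [g0 g1]; rewrite /S rmorphD !coefD f0 f1 g0 g1 -big_split /=.
  by split=> //; apply: eq_bigr => k _; rewrite mderivD mulrDl.
have SM f g : S f -> S g -> S (f * g).
  move=> [f0 f1] [g0 g1]; rewrite /S rmorphM coef0M coef1M f0 f1 g0 g1.
  split=> //; rewrite mulr_sumr mulr_suml -big_split /=.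
  by apply: eq_bigr => k _; rewrite mderivM; ring.
have SX k : S 'X_k.
  rewrite /S EX; split=> //; rewrite (bigD1 k) //= big1 ?addr0 => [|j nj].
    rewrite mderivX mnmE eqxx /= scale1r.
    by rewrite (_ : (_ - _)%MM = 0%MM) ?mpolyX0 ?mul1r //; apply/mnmP => i; rewrite !mnmE subnn.
  by rewrite mderivX mnmE eq_sym (negbTE nj) scale0r mul0r.
exact: mpoly_ring_ind.
Qed.

(** The i-th partial derivative is extended to lifts of all coordinates ['X_k]; its values there are
    the components of [v i], and [s i] is the accumulated denominator. *)
Lemma alg_independent_vectors (I : A -> Prop) (d : nat) :
    prime_ideal I -> (forall m, ~ I m.+1%:R) ->
    alg_independent I (@mpolyC N C : {rmorphism C -> A}) d ->
  exists (s : 'I_d -> A) (v : 'I_d -> 'I_N -> A) (y : 'I_d -> A),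
    [/\ forall i, ~ I (s i),
        forall i f, I f -> I (\sum_(k < N) f^`M(k) * v i k)
      & forall i j, I (\sum_(k < N) (y j)^`M(k) * v i k - (i == j)%:R * s i)].
Proof.
move=> Ip char0 [P [h [ev [y [D [D0 D1 Dh Iev]]]]]].
suff H (i : 'I_d) : exists (s : A) (v : 'I_N -> A),
    ~ I s /\ forall p f, I (ev p - f) ->
       I (\sum_(k < N) f^`M(k) * v k - s * (D i p)`_1).
  pose sv i := cid (H i); pose s i := sval (sv i).
  pose vv i := cid (svalP (sv i)).
  exists s, (fun i => sval (vv i)), (fun j => ev (y j)); split=> [i|i f If|i j].
  - exact: (svalP (vv i)).1.
  - have := (svalP (vv i)).2 0 f; rewrite !rmorph0 coef0 mulr0 subr0 sub0r; apply.
    by rewrite -mulN1r; apply: pidM.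
  - have := (svalP (vv i)).2 (y j) (ev (y j)); rewrite subrr => /(_ (pid0 Ip)).
    by rewrite D1 // mulrC val_eqE.
have Dl : liftable I (D i).
  by move=> p; rewrite D0 => /Iev ->; rewrite rmorph0 coef0; apply: pid0.
pose xs : seq A := [seq 'X_k | k <- enum 'I_N].
have [s [Q [j [X [E [nIs El E01 EX]]]]]] := extend_liftable_seq Ip char0 xs Dl.
have {}EX (k : 'I_N) : (E (X (val k)))`_0 = 'X_k.
  have ltk : (k < size (enum 'I_N))%N by rewrite size_enum_ord.
  rewrite EX; last by rewrite size_map.
  apply: etrans (nth_map k 0 (fun i : 'I_N => 'X_i : {mpoly C[N]}) ltk) _.
  by rewrite nth_ord_enum.
pose L : {rmorphism A -> Q} := mmap (j \o h) (fun k : 'I_N => X k).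
have LC c : L c%:MP = j (h c) by rewrite /L /= mmapC.
have LX k : L 'X_k = X k by rewrite /L /= mmapX mmap1U.
exists s, (fun k => (E (X k))`_1); split=> // p f Ipf.
have [EL0 EL1] : (E (L f))`_0 = f /\
    (E (L f))`_1 = \sum_(k < N) f^`M(k) * (E (L 'X_k))`_1.
  apply: (@mpoly_jet (E \o L)) => [c|k] /=; last first.
    by rewrite LX; apply: EX.
  by move: (LC c) => /= ->; have [-> ->] := E01 (h c); rewrite Dh !coefC mulr0.
(* [L f] and [j p] have the same evaluation modulo [I], so liftability identifies their derivatives.
   Taking [p = 0] gives tangency, and [p = y j] the Jacobian entries. *)
have : I (E (L f - j p))`_1.
  apply: El; rewrite rmorphB coefB EL0 (E01 p).1 D0 -opprB -mulN1r.
  exact: pidM.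
rewrite rmorphB coefB EL1 (E01 p).2.
by under eq_bigr => k _ do rewrite /= LX.
Qed.

End TangentBound.

(** * Tangent spaces of affine varieties *)

Section Tangent.
Variables (C : closedFieldType) (N : nat).
Local Notation A := {mpoly C[N]}.
Implicit Types (X : set 'rV[C]_N) (x v : 'rV[C]_N).

Lemma dim_lker_mulmx k (M : 'M[C]_(N, k)) (B : 'M[C]_(k, N)) :
    B *m M \in unitmx ->
  \dim (lker (linfun (mulmxr M : 'rV_N -> 'rV_k))) = (N - k)%N.
Proof.
move=> BM; set f := linfun _.
have sf : (f @: fullv = fullv)%VS.
  apply/eqP; rewrite eqEsubv subvf; apply/subvP => w _.
  have -> : w = f (w *m invmx (B *m M) *m B).
    by rewrite lfunE /= -!mulmxA mulVmx // mulmx1.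
  by apply: memv_img; rewrite memvf.
have := limg_ker_dim f fullv; rewrite sf capfv !dimvf !dim_matrix !mul1r.
by move=> /(congr1 (subn^~ k)) /=; rewrite addnK.
Qed.

Definition jacobian k (F : 'I_k -> A) x : 'M[C]_(N, k) :=
  \matrix_(i < N, j < k) (F j)^`M(i).@[x 0].

Lemma mul_jacobian k (F : 'I_k -> A) x v :
  v *m jacobian F x = \row_j \sum_(i < N) (F j)^`M(i).@[x 0] * v 0 i.
Proof.
by apply/rowP => j; rewrite !mxE; apply: eq_bigr => i _; rewrite !mxE mulrC.
Qed.

(** Independent differentials at [x] number at most [N]. In a maximal independent family taken from
    the ideal, any further differential is a combination of the chosen ones. *)
Lemma tangent_jacobian_kernel X x :
  exists k (F : 'I_k -> A),
    [/\ forall j, vanishing_ideal X (F j),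
        row_free (jacobian F x)^T &
        forall v, tangent X x v <-> v *m jacobian F x = 0].
Proof.
pose indep k := exists F : 'I_k -> A,
  (forall j, vanishing_ideal X (F j)) /\ row_free (jacobian F x)^T.
have ex0 : exists k, `[< indep k >].
  exists 0%N; apply/asboolP; exists (fun=> 0); split; first by case.
  by rewrite /row_free; apply/eqP/eqP; rewrite -leqn0 rank_leq_row.
have maxN k : `[< indep k >] -> (k <= N)%N.
  by case/asboolP => F [_ /eqP <-]; apply: rank_leq_col.
case: (ex_maxnP ex0 maxN) => k /asboolP [F [IF rF]] kmax.
exists k, F; split=> // v; split=> [Tv|vJ].
  rewrite mul_jacobian; apply/rowP => j; rewrite !mxE; exact: Tv.
move=> f If; apply: contrapT => nz.
suff : (k + 1 <= k)%N by rewrite addn1 ltnn.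
apply: kmax; apply/asboolP.
exists (fun j => match split j with inl i => F i | inr _ => f end); split.
  by move=> j; case: splitP => i _.
set J := jacobian _ x.
have JE : J = row_mx (jacobian F x) (jacobian (fun _ : 'I_1 => f) x).
  apply/matrixP => i j; rewrite !mxE; case: splitP => l _; by rewrite !mxE.
apply: inj_row_free => w; rewrite JE -[w in LHS]trmxK -trmx_mul => /(congr1 trmx).
rewrite trmxK trmx0 -[w^T]vsubmxK mul_row_col => Jw.
(* Pairing the relation with [v] isolates the coefficient of [f], since [v] kills the other
   differentials. *)
have w1 : dsubmx w^T = 0.
  have := congr1 (mulmx v) Jw; rewrite mulmxDr !mulmxA vJ mul0mx add0r mulmx0.
  rewrite mul_jacobian => /matrixP/(_ 0 0); rewrite !mxE big_ord1 !mxE => /eqP.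
  rewrite mulf_eq0 => /orP[/eqP//|/eqP w0].
  by apply/matrixP => i j; rewrite (ord1 i) (ord1 j) !mxE.
have w2 : usubmx w^T = 0.
  move: Jw; rewrite w1 mulmx0 addr0 => Jw.
  apply: trmx_inj; rewrite trmx0; apply: (row_free_inj rF).
  by rewrite mul0mx -trmx_mul Jw trmx0.
by rewrite -[w]trmxK -[w^T]vsubmxK w1 w2 col_mx0 trmx0.
Qed.

Lemma tangent_vspace X x :
  exists T : {vspace 'rV[C]_N}, forall v, v \in T <-> tangent X x v.
Proof.
have [k [F [_ _ TF]]] := tangent_jacobian_kernel X x.
exists (lker (linfun (mulmxr (jacobian F x) : 'rV_N -> 'rV_k))) => v.
by rewrite memv_ker lfunE /= TF; split=> /eqP.
Qed.

(** [P] is the determinant of the Jacobian of these equations times its right inverse at [x0]. Where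
    it is nonzero the equations keep their rank, and they still hold on the tangent space since they
    belong to the ideal of [X]. *)
Lemma tangent_upper_semicontinuous X x0 (T0 : {vspace 'rV[C]_N}) :
    (forall v, v \in T0 <-> tangent X x0 v) ->
  exists2 P : A, P.@[x0 0] != 0 &
    forall x (T : {vspace 'rV[C]_N}), P.@[x 0] != 0 ->
      (forall v, v \in T <-> tangent X x v) -> (\dim T <= \dim T0)%N.
Proof.
move=> T0E; have [k [F [IF /row_freeP [B BE] TF]]] := tangent_jacobian_kernel X x0.
pose G : 'M[A]_k := \matrix_(j, l) \sum_i (F j)^`M(i) * (B i l)%:MP.
have GE x : map_mx (meval (x 0)) G = (jacobian F x)^T *m B.
  apply/matrixP => j l; rewrite !mxE rmorph_sum /=; apply: eq_bigr => i _.
  by rewrite !mxE mevalM mevalC.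
have dimT x (T : {vspace 'rV[C]_N}) :
    ((jacobian F x)^T *m B) \in unitmx ->
    (forall v, v *m jacobian F x = 0 <-> v \in T) -> \dim T = (N - k)%N.
  rewrite -unitmx_tr trmx_mul trmxK => /dim_lker_mulmx <- TE; congr (\dim _).
  apply/vspaceP => v; rewrite memv_ker lfunE /=.
  by apply/idP/eqP => /TE.
exists (\det G) => [|x T].
  by rewrite -det_map_mx GE BE det1 oner_eq0.
rewrite -det_map_mx GE => detn0 TE.
rewrite (dimT x0 T0) ?BE ?unitmx1 //; last first.
  by move=> v; split=> [/TF/T0E|/T0E/TF].
rewrite -(dimT x (lker (linfun (mulmxr (jacobian F x) : 'rV_N -> 'rV_k)))).
- apply/dimvS/subvP => v /TE Tv; rewrite memv_ker lfunE /= mul_jacobian.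
  by apply/eqP/rowP => j; rewrite !mxE; apply: Tv.
- by rewrite unitmxE unitfE.
- by move=> v; rewrite memv_ker lfunE /=; split=> /eqP.
Qed.

(** The open set [P != 0] is there so that the point can be taken where semicontinuity applies. Off
    the zeros of the [s i], the Jacobian of [y] sends the vectors [v i] to nonzero multiples of the
    unit vectors. *)
Lemma chain_le_tangent_dim (char0 : [pchar C] =i pred0)
    (X : nat -> set 'rV[C]_N) (d : nat) (P : A) :
    (forall i, (i <= d)%N -> prime_ideal (vanishing_ideal (X i))) ->
    (forall i, (i < d)%N -> (X i `<=` X i.+1)%classic) ->
    (forall i, (i < d)%N -> exists2 f, vanishing_ideal (X i) f
                                     & ~ vanishing_ideal (X i.+1) f) ->
    ~ vanishing_ideal (X d) P ->
  exists x, [/\ X d x, P.@[x 0] != 0 &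
    forall T : {vspace 'rV[C]_N}, (forall v, v \in T <-> tangent (X d) x v) ->
      (d <= \dim T)%N].
Proof.
move=> Xp Xs Xn nP.
have Xpd := Xp d (leqnn d).
have natN m : ~ vanishing_ideal (X d) m.+1%:R.
  move=> H; apply: (pid1 Xpd).
  have mn0 : m.+1%:R != 0 :> C by rewrite ((pcharf0P C).1 char0).
  rewrite -mpolyC1 -(mulVf mn0) mpolyCM mpolyC_nat.
  exact: (pidM Xpd).
have aind : alg_independent (vanishing_ideal (X d)) (@mpolyC N C) d.
  apply: (@prime_chain_alg_independent _ _ _ (fun i => vanishing_ideal (X i))) => //.
  by move=> i f lt_id If x Xx; apply: If; apply: Xs.
have [s [v [y [nIs Iv Iy]]]] := alg_independent_vectors Xpd natN aind.
have : ~ vanishing_ideal (X d) (P * \prod_i s i).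
  by move/(pid_cancel Xpd nP); apply: pid_prod.
move=> nI; have [x [Xx Px]] : exists x, X d x /\ (P * \prod_i s i).@[x 0] != 0.
  apply: contrapT => H; apply: nI => x Xx; apply/eqP/negPn/negP => Px.
  by apply: H; exists x.
move: Px; rewrite mevalM mulf_eq0 negb_or rmorph_prod => /andP[Px /prodf_neq0 sx].
exists x; split=> // T TE.
pose M := jacobian y x; pose f := linfun (mulmxr M : 'rV_N -> 'rV_d).
pose w i : 'rV[C]_N := \row_k (v i k).@[x 0].
have wT i : w i \in T.
  apply/TE => g Ig; rewrite -[RHS](Iv i g Ig x Xx) rmorph_sum /=.
  by apply: eq_bigr => k _; rewrite rmorphM mxE.
have fw i : f (w i) = (s i).@[x 0] *: delta_mx 0 i.
  rewrite lfunE /= mul_jacobian; apply/rowP => j; rewrite !mxE eqxx /= eq_sym.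
  have := Iy i j x Xx; rewrite rmorphB rmorphM => /eqP; rewrite subr_eq0 => /eqP.
  rewrite rmorph_nat rmorph_sum mulrC => <-.
  by apply: eq_bigr => k _; rewrite rmorphM mxE.
have -> : d = \dim (f @: T)%VS.
  rewrite -[LHS]mul1r -(@dim_matrix C 1 d) -dimvf; congr (\dim _); apply/eqP.
  rewrite eqEsubv subvf andbT; apply/subvP => z _.
  rewrite [z]row_sum_delta; apply: memv_suml => i _; apply: memvZ.
  rewrite -[delta_mx _ _](scalerK (sx i isT)) -fw; apply: memvZ.
  exact: memv_img.
by rewrite -(limg_ker_dim f T) leq_addl.
Qed.

End Tangent.

(** * Flags and matrices *)

Section Flags.
Variables (C : closedFieldType) (V : vectType C) (n : nat).
Hypothesis dimV : \dim {:V} = n.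
Implicit Types (b c : n.-tuple V) (M T L : 'M[C]_n).

Definition vec b (a : 'cV[C]_n) : V := \sum_i a i 0 *: tnth b i.

Definition bas b M : n.-tuple V := [tuple vec b (col j M) | j < n].

Definition coordmx b c : 'M[C]_n := \matrix_(i, j) coord b i (tnth c j).

Definition is_upper (R : nzRingType) (T : 'M[R]_n) :=
  forall i j : 'I_n, (j < i)%N -> T i j = 0.

Lemma tnth_bas b M j : tnth (bas b M) j = vec b (col j M).
Proof. by rewrite tnth_mktuple. Qed.

Lemma vec_bas b M a : vec (bas b M) a = vec b (M *m a).
Proof.
rewrite /vec; under eq_bigr => j _ do rewrite tnth_bas scaler_sumr.
rewrite exchange_big /=; apply: eq_bigr => i _.
rewrite mxE scaler_suml; apply: eq_bigr => j _.
by rewrite mxE scalerA mulrC.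
Qed.

Lemma bas_bas b M T : bas (bas b M) T = bas b (M *m T).
Proof.
by apply: eq_from_tnth => j; rewrite !tnth_bas vec_bas !colE mulmxA.
Qed.

Lemma bas1 b : bas b 1%:M = b.
Proof.
apply: eq_from_tnth => j; rewrite tnth_bas /vec (bigD1 j) //= big1 => [|i nij].
  by rewrite !mxE eqxx scale1r addr0.
by rewrite !mxE (negbTE nij) scale0r.
Qed.

Lemma bas_coordmx b c : basis_of fullv b -> bas b (coordmx b c) = c.
Proof.
move=> bb; apply: eq_from_tnth => j; rewrite tnth_bas.
rewrite [RHS](coord_basis bb (memvf _)); apply: eq_bigr => i _.
by rewrite !mxE (tnth_nth 0 b).
Qed.

Lemma vec_inj b : basis_of fullv b -> injective (vec b).
Proof.
move=> bb a a' Eaa'; apply/colP => i.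
have cv a1 : coord b i (vec b a1) = a1 i 0.
  rewrite /vec linear_sum (bigD1 i) //= big1 => [|j nij].
    by rewrite linearZ /= (tnth_nth 0) coord_free ?(basis_free bb) // eqxx mulr1 addr0.
  by rewrite linearZ /= (tnth_nth 0) coord_free ?(basis_free bb) // (negbTE nij) mulr0.
by rewrite -cv Eaa' cv.
Qed.

Lemma bas_inj b : basis_of fullv b -> injective (bas b).
Proof.
move=> bb M M' E; apply/matrixP => i j.
have := congr1 (fun c => tnth c j) E; rewrite /= !tnth_bas => /(vec_inj bb).
by move=> /matrixP/(_ i 0); rewrite !mxE.
Qed.

Lemma basis_bas b M : basis_of fullv b -> (M \in unitmx) = basis_of fullv (bas b M).
Proof.
move=> bb; apply/idP/idP => [uM|bM].
  rewrite basisEdim size_tuple dimV leqnn andbT -(span_basis bb).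
  apply/span_subvP => v /tnthP[i ->].
  rewrite -[b in tnth b i]bas1 -(mulmxV uM) -bas_bas tnth_bas.
  by apply: memv_suml => j _; apply/memvZ/memv_span/mem_tnth.
have := bas_coordmx b bM; rewrite bas_bas -[RHS]bas1 => /(bas_inj bb).
by move/mulmx1_unit => [].
Qed.

Lemma coordmx_unit b c : basis_of fullv b -> basis_of fullv c -> coordmx b c \in unitmx.
Proof. by move=> bb bc; rewrite (basis_bas _ bb) bas_coordmx. Qed.

Lemma span_takeE k c : (<<take k c>> = \sum_(i < n | (i < k)%N) <[tnth c i]>)%VS.
Proof.
apply/eqP; rewrite eqEsubv; apply/andP; split.
  apply/span_subvP => v; case/(nthP (0 : V)) => i; rewrite size_take_min size_tuple leq_min.
  move=> /andP[lt_ik lt_in]; rewrite nth_take // => <-.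
  rewrite memvE; apply: (sumv_sup (Ordinal lt_in)) => //.
  by rewrite -memvE (tnth_nth 0) memv_line.
apply/subv_sumP => i lt_ik; rewrite -memvE; apply: memv_span.
rewrite (tnth_nth 0) -(nth_take _ lt_ik); apply: mem_nth.
by rewrite size_take_min size_tuple leq_min lt_ik ltn_ord.
Qed.

Lemma span_takeP k c v :
  reflect (exists2 a : 'cV[C]_n, forall i : 'I_n, (k <= i)%N -> a i 0 = 0 & v = vec c a)
          (v \in <<take k c>>%VS).
Proof.
rewrite span_takeE; apply: (iffP idP) => [|[a a0 ->]]; last first.
  rewrite /vec (bigID (fun i : 'I_n => (i < k)%N)) /= [X in _ + X]big1 ?addr0.
    by apply: memv_sumr => i _; apply/memvZ/memv_line.
  by move=> i; rewrite -leqNgt => /a0 ->; rewrite scale0r.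
case/memv_sumP => vs vsP ->.
have vsa (i : 'I_n) : exists x, (i < k)%N -> vs i = x *: tnth c i.
  by case: ltnP => [/vsP/vlineP[x ->]|_]; [exists x | exists 0].
have [a aE] := choice vsa.
exists (\col_i if (i < k)%N then a i else 0).
  by move=> i le_ki; rewrite mxE ltnNge le_ki.
rewrite /vec big_mkcond /=; apply: eq_bigr => i _; rewrite mxE.
by case: ltnP => [/aE|_] //; rewrite scale0r.
Qed.

Lemma dim_span_take k b : basis_of fullv b -> (k <= n)%N -> \dim <<take k b>> = k.
Proof.
move=> bb le_kn.
have : free (take k b).
  by have := basis_free bb; rewrite -{1}(cat_take_drop k b) => /catl_free.
by rewrite /free size_take_min size_tuple (minn_idPl le_kn) => /eqP.
Qed.

Lemma span_takeS k l c : (k <= l)%N -> (<<take k c>> <= <<take l c>>)%VS.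
Proof.
move=> le_kl; apply/subvP => v /span_takeP[a a0 ->]; apply/span_takeP; exists a => //.
by move=> i le_li; rewrite a0 // (leq_trans le_kl).
Qed.

Lemma flag_of_is_flag b : basis_of fullv b -> is_flag (flag_of b).
Proof.
move=> bb; split.
- by move=> i; rewrite ffunE dim_span_take // -ltnS.
- by move=> i j le_ij; rewrite !ffunE span_takeS.
- by rewrite ffunE /= take_oversize ?size_tuple // (span_basis bb).
Qed.

Lemma mem_flag_of c (k : 'I_n.+1) v : (v \in flag_of c k) = (v \in <<take k c>>%VS).
Proof. by rewrite ffunE. Qed.

(** The flag variety as invertible matrices modulo right multiplication by upper triangular ones;
    the columns span the flag. *)
Lemma flag_upperP b M M' : basis_of fullv b -> M \in unitmx -> M' \in unitmx ->
  flag_of (bas b M) = flag_of (bas b M') <-> exists2 T, is_upper T & M = M' *m T.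
Proof.
move=> bb uM uM'; have bM := uM; have bM' := uM'.
rewrite (basis_bas _ bb) in bM; rewrite (basis_bas _ bb) in bM'.
split=> [E|[T uT MT]]; last first.
  apply/ffunP => k; rewrite !ffunE; apply/eqP; rewrite eqEdim.
  have le_kn : (k <= n)%N by rewrite -ltnS.
  rewrite !dim_span_take // leqnn andbT.
  apply/subvP => v /span_takeP[a a0 ->]; apply/span_takeP; exists (T *m a).
    move=> i le_ki; rewrite mxE big1 // => j _.
    have [le_kj|lt_jk] := leqP k j; first by rewrite a0 // mulr0.
    by rewrite uT ?mul0r // (leq_trans lt_jk).
  by rewrite !vec_bas MT mulmxA.
have colj (j : 'I_n) : exists a : 'cV_n, (forall i : 'I_n, (j < i)%N -> a i 0 = 0) /\ col j M = M' *m a.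
  have : vec b (col j M) \in flag_of (bas b M') (lift ord0 j).
    rewrite -E mem_flag_of -tnth_bas; apply: memv_span.
    have ltj : (j < lift ord0 j)%N by rewrite lift0.
    rewrite (tnth_nth 0) -(nth_take _ ltj); apply: mem_nth.
    by rewrite size_take_min size_tuple leq_min ltj ltn_ord.
  rewrite mem_flag_of => /span_takeP[a a0]; rewrite vec_bas => /(vec_inj bb) aE.
  by exists a; split=> // i lt_ji; apply: a0; rewrite lift0.
have [a aE] := choice colj.
exists (\matrix_(i, j) a j i 0) => [i j lt_ji|].
  by rewrite mxE (aE j).1.
apply/matrixP => i j; have /matrixP/(_ i 0) := (aE j).2; rewrite !mxE => ->.
by apply: eq_bigr => k _; rewrite !mxE.
Qed.

Lemma is_flag_basis (F : preflag V n) :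
  is_flag F -> exists2 c : n.-tuple V, basis_of fullv c & F = flag_of c.
Proof.
move=> [dF sF Fn].
have vex (j : 'I_n) : exists v, v \in F (lift ord0 j) /\ v \notin F (widen_ord (leqnSn n) j).
  have : ~~ (F (lift ord0 j) <= F (widen_ord (leqnSn n) j))%VS.
    by apply/negP => /dimvS; rewrite !dF lift0 /= ltnn.
  by case/subvPn => v v1 v2; exists v.
have [w wE] := choice vex; pose c := [tuple w j | j < n].
have cF k (lt_k : (k < n.+1)%N) : <<take k c>>%VS = F (Ordinal lt_k).
  elim: k lt_k => [|k IHk] lt_k.
    by rewrite take0 span_nil; apply/esym/eqP; rewrite -dimv_eq0 dF.
  have lt_k' : (k < n.+1)%N by apply: ltnW.
  have lt_kn : (k < n)%N by rewrite -ltnS.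
  have [w1 w2] := wE (Ordinal lt_kn).
  have E1 : lift ord0 (Ordinal lt_kn) = Ordinal lt_k by apply: val_inj.
  have E2 : widen_ord (leqnSn n) (Ordinal lt_kn) = Ordinal lt_k' by apply: val_inj.
  rewrite E1 in w1; rewrite E2 in w2.
  rewrite (take_nth 0) ?size_tuple // -cats1 span_cat span_seq1 IHk.
  rewrite -[nth _ _ _]/(nth 0 c (Ordinal lt_kn)) -tnth_nth tnth_mktuple.
  apply/eqP; rewrite eqEdim subv_add sF //= -memvE w1 dF /=.
  rewrite ltnNge; apply: contra w2 => le_dim.
  have /eqP-> : F (Ordinal lt_k') == (F (Ordinal lt_k') + <[w (Ordinal lt_kn)]>)%VS.
    by rewrite eqEdim addvSl dF.
  by rewrite memvE addvSr.
exists c; last first.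
  by apply/ffunP => -[k lt_k]; rewrite ffunE (cF k lt_k).
rewrite basisEdim size_tuple dimV leqnn andbT -Fn.
by rewrite -[c in <<c>>%VS]take_size size_tuple (cF n (ltnSn n)) (_ : ord_max = Ordinal (ltnSn n)) //; apply: val_inj.
Qed.

End Flags.

(** * Coordinates in the big cells *)

Section FunctionRings.
Variables (C : comNzRingType) (T : Type) (S : (T -> C) -> Prop).

(** Polynomiality of determinants, adjugates and cell coordinates is proved once, then used for
    functions on a cell ([mpolyfun]) and for functions of a curve parameter ([polyfun]). *)
Record fun_subring : Prop := FunSubring {
  fsC : forall c, S (fun=> c);
  fsD : forall f g, S f -> S g -> S (fun t => f t + g t);
  fsM : forall f g, S f -> S g -> S (fun t => f t * g t) }.

Hypothesis Sring : fun_subring.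

Lemma fs_ext f g : S f -> f =1 g -> S g.
Proof. by move=> Sf /funext <-. Qed.

Lemma fs_sum (J : Type) (r : seq J) (Q : pred J) (F : J -> T -> C) :
  (forall j, S (F j)) -> S (fun t => \sum_(j <- r | Q j) F j t).
Proof.
move=> SF; elim: r => [|j r IHr].
  by apply: (fs_ext (fsC Sring 0)) => t; rewrite big_nil.
case Qj: (Q j).
  by apply: (fs_ext (fsD Sring (SF j) IHr)) => t; rewrite big_cons Qj.
by apply: (fs_ext IHr) => t; rewrite big_cons Qj.
Qed.

Lemma fs_prod (J : Type) (r : seq J) (Q : pred J) (F : J -> T -> C) :
  (forall j, S (F j)) -> S (fun t => \prod_(j <- r | Q j) F j t).
Proof.
move=> SF; elim: r => [|j r IHr].
  by apply: (fs_ext (fsC Sring 1)) => t; rewrite big_nil.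
case Qj: (Q j).
  by apply: (fs_ext (fsM Sring (SF j) IHr)) => t; rewrite big_cons Qj.
by apply: (fs_ext IHr) => t; rewrite big_cons Qj.
Qed.

Lemma fs_expn f k : S f -> S (fun t => f t ^+ k).
Proof.
move=> Sf; elim: k => [|k IHk].
  by apply: (fs_ext (fsC Sring 1)) => t; rewrite expr0.
by apply: (fs_ext (fsM Sring Sf IHk)) => t; rewrite exprS.
Qed.

Lemma fs_mulmx m n p (A : T -> 'M[C]_(m, n)) (B : T -> 'M[C]_(n, p)) :
    (forall i j, S (fun t => A t i j)) -> (forall i j, S (fun t => B t i j)) ->
  forall i j, S (fun t => (A t *m B t) i j).
Proof.
move=> SA SB i j; apply: (@fs_ext (fun t => \sum_k A t i k * B t k j)).
  by apply: fs_sum => k; apply: fsM.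
by move=> t; rewrite mxE.
Qed.

Lemma fs_det m (A : T -> 'M[C]_m) :
  (forall i j, S (fun t => A t i j)) -> S (fun t => \det (A t)).
Proof.
move=> SA; rewrite /determinant; apply: fs_sum => s.
by apply: fsM => //; [exact: fsC | apply: fs_prod].
Qed.

Lemma fs_adj m (A : T -> 'M[C]_m) :
    (forall i j, S (fun t => A t i j)) ->
  forall i j, S (fun t => (\adj (A t)) i j).
Proof.
move=> SA i j; apply: (@fs_ext (fun t => (-1) ^+ (j + i) * \det (row' j (col' i (A t))))).
  apply: fsM => //; first exact: fsC.
  apply: fs_det => k l; apply: fs_ext (SA (lift j k) (lift i l)) _ => t.
  by rewrite !mxE.
by move=> t; rewrite mxE.
Qed.

End FunctionRings.

Section Cells.
Variables (C : closedFieldType) (V : vectType C) (n : nat).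
Hypothesis dimV : \dim {:V} = n.
Implicit Types (b c : n.-tuple V) (M T L : 'M[C]_n).
Local Notation N := (cell_dim n).
Implicit Type x : 'rV[C]_N.

Definition lowmx x : 'M[C]_n :=
  \matrix_(i, j) ((i == j)%:R + \sum_(p : lowpos n | val p == (i, j)) x 0 (enum_rank p)).

Lemma cell_basisE b x : cell_basis b x = bas b (lowmx x).
Proof.
apply: eq_from_tnth => j; rewrite tnth_bas tnth_mktuple /vec.
under [RHS]eq_bigr => i _ do rewrite !mxE scalerDl scaler_suml.
rewrite big_split /=; congr (_ + _).
  rewrite (bigD1 j) //= eqxx scale1r big1 ?addr0 // => i nij.
  by rewrite (negbTE nij) scale0r.
rewrite (exchange_big_dep (fun p : lowpos n => (val p).2 == j)) /=; last first.
  by move=> i p _ /eqP ->.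
apply: eq_bigr => p /eqP pj; rewrite (big_pred1 (val p).1) // => i.
by rewrite -pj /= {1}(surjective_pairing (val p)) xpair_eqE eqxx andbT eq_sym.
Qed.

Lemma lowmx_upper x (i j : 'I_n) : (i <= j)%N -> lowmx x i j = (i == j)%:R.
Proof.
move=> le_ij; rewrite mxE big1 ?addr0 // => p /eqP pE.
by have := valP p; rewrite pE /= ltnNge le_ij.
Qed.

Lemma lowmx_lower x (p : lowpos n) :
  lowmx x (val p).1 (val p).2 = x 0 (enum_rank p).
Proof.
rewrite mxE -val_eqE gtn_eqF ?(valP p) // add0r -surjective_pairing.
by rewrite (big_pred1 p) // => q; rewrite (inj_eq val_inj).
Qed.

Lemma lowmx_inj : injective lowmx.
Proof.
move=> x y E; apply/rowP => q; have := congr1 (fun M => M (val (enum_val q)).1 (val (enum_val q)).2) E.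
by rewrite /= !lowmx_lower enum_valK.
Qed.

Lemma det_lowmx x : \det (lowmx x) = 1.
Proof.
rewrite det_trig; last first.
  apply/is_trig_mxP => i j lt_ij; rewrite lowmx_upper ?(ltnW lt_ij) //.
  by rewrite -val_eqE (ltn_eqF lt_ij).
by rewrite big1 // => i _; rewrite lowmx_upper // eqxx.
Qed.

Lemma lowmx_unit x : lowmx x \in unitmx.
Proof. by rewrite unitmxE det_lowmx unitr1. Qed.

Lemma cell_basis_basis b x : basis_of fullv b -> basis_of fullv (cell_basis b x).
Proof. by move=> bb; rewrite cell_basisE -(basis_bas dimV) // lowmx_unit. Qed.

Lemma is_upper_diag T (i : 'I_n) : is_upper T -> T \in unitmx -> T i i != 0.
Proof.
move=> uT; rewrite unitmxE unitfE -det_tr det_trig; last first.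
  by apply/is_trig_mxP => k l lt_kl; rewrite mxE uT.
by move/prodf_neq0/(_ i isT); rewrite mxE.
Qed.

Definition leading (j : 'I_n) M : 'M[C]_(j.+1) :=
  mxsub (widen_ord (ltn_ord j)) (widen_ord (ltn_ord j)) M.

Lemma leadingE (j : 'I_n) M p q :
  leading j M p q = M (widen_ord (ltn_ord j) p) (widen_ord (ltn_ord j) q).
Proof. by rewrite mxE. Qed.

Definition leading_minors M : C := \prod_j \det (leading j M).

(** Cramer numerator of an entry of the unipotent lower factor in the LU factorization of [M]; the
    denominator is a leading minor. *)
Definition cellnum M (p : lowpos n) : C :=
  \sum_(k < (val p).2.+1) M (val p).1 (widen_ord (ltn_ord (val p).2) k)
      * (\adj (leading (val p).2 M)) k ord_max.

Definition cellpoint M : 'rV[C]_N :=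
  \row_q (cellnum M (enum_val q) / \det (leading (val (enum_val q)).2 M)).

Lemma sum_widen (j : 'I_n) (F : 'I_n -> C) :
    (forall i : 'I_n, (j < i)%N -> F i = 0) ->
  \sum_i F i = \sum_(k < j.+1) F (widen_ord (ltn_ord j) k).
Proof.
move=> F0; rewrite (bigID (fun i : 'I_n => (i < j.+1)%N)) /= [X in _ + X]big1 ?addr0.
  by rewrite (big_ord_narrow (ltn_ord j)).
by move=> i; rewrite -leqNgt => /F0.
Qed.

Lemma leading_mul (j : 'I_n) L T : is_upper T -> leading j (L *m T) = leading j L *m leading j T.
Proof.
move=> uT; apply/matrixP => p q; rewrite !mxE (sum_widen (j := j)).
  by apply: eq_bigr => k _; rewrite !mxE.
by move=> i lt_ji; rewrite uT ?mulr0 // (leq_trans _ lt_ji) //= ltnS -ltnS.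
Qed.

Lemma leading_minors_lowmx x T : is_upper T -> T \in unitmx ->
  leading_minors (lowmx x *m T) != 0.
Proof.
move=> uT T1; apply/prodf_neq0 => j _; rewrite leading_mul // det_mulmx mulf_neq0 //.
  rewrite det_trig; last first.
    apply/is_trig_mxP => k l lt_kl; rewrite mxE lowmx_upper ?(ltnW lt_kl) //.
    by rewrite -val_eqE /= (ltn_eqF lt_kl).
  apply/prodf_neq0 => k _; rewrite mxE lowmx_upper // eqxx; exact: oner_neq0.
rewrite -det_tr det_trig; last first.
  by apply/is_trig_mxP => k l lt_kl; rewrite !mxE uT.
by apply/prodf_neq0 => k _; rewrite !mxE is_upper_diag.
Qed.

(* Normalising the first j + 1 columns of M so that their leading block becomes
   the identity matrix gives the columns of the cell basis. *)
Lemma lowmx_cellpoint M : leading_minors M != 0 ->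
  exists2 T, is_upper T & lowmx (cellpoint M) = M *m T.
Proof.
move=> /prodf_neq0 dn0.
pose T : 'M[C]_n := \matrix_(i, j)
  if insub (val i) is Some k then (\adj (leading j M)) k ord_max / \det (leading j M) else 0.
have Tw (j : 'I_n) (k : 'I_j.+1) :
    T (widen_ord (ltn_ord j) k) j = (\adj (leading j M)) k ord_max / \det (leading j M).
  by rewrite mxE /= valK.
have uT : is_upper T.
  by move=> i j lt_ji; rewrite mxE insubN // -leqNgt.
exists T => //; apply/matrixP => i j; rewrite [RHS]mxE (sum_widen (j := j)); last first.
  by move=> k lt_jk; rewrite uT ?mulr0.
under [RHS]eq_bigr => k _ do rewrite Tw mulrA.
rewrite -mulr_suml; have [le_ij|lt_ji] := leqP i j; last first.
  pose p : lowpos n := Sub (i, j) lt_ji.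
  by have := lowmx_lower (cellpoint M) p; rewrite /= => ->; rewrite mxE enum_rankK.
rewrite lowmx_upper //; have lt_ij : (i < j.+1)%N by [].
have := congr1 (fun A : 'M_(j.+1) => A (Ordinal lt_ij) ord_max) (mul_mx_adj (leading j M)).
rewrite /= mxE [RHS]mxE.
rewrite (eq_bigr (fun k => M i (widen_ord (ltn_ord j) k) * (\adj (leading j M)) k ord_max)).
  move=> ->; rewrite -[Ordinal _ == _]/(val i == val j) (inj_eq val_inj).
  by case: eqP => _; rewrite ?mul0r // mulr1n divff // dn0.
by move=> k _; rewrite leadingE; congr (M _ _ * _); apply: val_inj.
Qed.

Lemma flag_cellpoint b M : basis_of fullv b -> M \in unitmx -> leading_minors M != 0 ->
  flag_of (bas b M) = flag_of (cell_basis b (cellpoint M)).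
Proof.
move=> bb uM /lowmx_cellpoint TE; apply/esym; rewrite cell_basisE.
by apply/(flag_upperP dimV) => //; apply: lowmx_unit.
Qed.

Lemma flag_cell_inj b : basis_of fullv b -> injective (fun x => flag_of (cell_basis b x)).
Proof.
move=> bb x y; rewrite !cell_basisE => /(flag_upperP dimV bb).
case=> [||T uT E]; try exact: lowmx_unit.
apply: lowmx_inj; rewrite E; suff -> : T = 1%:M by rewrite mulmx1.
apply/matrixP => i j; rewrite mxE; have [le_ij|lt_ji] := leqP i j; last first.
  by rewrite uT // -val_eqE gtn_eqF.
have [m] := ubnP (val i); elim: m i le_ij => // m IHm i le_ij lt_im.
have := congr1 (fun A : 'M_n => A i j) E; rewrite /= lowmx_upper // mxE => ->.
rewrite (bigD1 i) //= lowmx_upper // eqxx mul1r big1 ?addr0 // => k nki.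
have [lt_ki|le_ik] := ltnP k i.
  have lt_kj := leq_trans lt_ki le_ij.
  rewrite (IHm k (ltnW lt_kj) (leq_trans lt_ki lt_im)).
  by rewrite -val_eqE (ltn_eqF lt_kj) mulr0.
by rewrite lowmx_upper // eq_sym (negbTE nki) mul0r.
Qed.

Lemma flag_in_cell b M x : basis_of fullv b -> M \in unitmx ->
  flag_of (bas b M) = flag_of (cell_basis b x) -> leading_minors M != 0 /\ x = cellpoint M.
Proof.
move=> bb uM E; have n0 : leading_minors M != 0.
  move: E; rewrite cell_basisE => /(flag_upperP dimV bb uM (lowmx_unit x)) [T uT ME].
  move: uM; rewrite ME unitmx_mul => /andP[_ uT1].
  exact: leading_minors_lowmx.
by split=> //; apply: (flag_cell_inj bb); rewrite -flag_cellpoint.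
Qed.

Section CellFunctions.
Variables (D : Type) (S : (D -> C) -> Prop).
Hypothesis Sring : fun_subring S.
Variable M : D -> 'M[C]_n.
Hypothesis SM : forall i j, S (fun t => M t i j).

Lemma fs_leading j : S (fun t => \det (leading j (M t))).
Proof.
apply: fs_det => // p q.
by apply: fs_ext (SM (widen_ord (ltn_ord j) p) (widen_ord (ltn_ord j) q)) _ => t; rewrite mxE.
Qed.

Lemma fs_leading_minors : S (fun t => leading_minors (M t)).
Proof. by apply: fs_prod => // j; apply: fs_leading. Qed.

(** Cell coordinates are fractions with leading minors as denominators; a power of [leading_minors]
    clears them without changing the zeros inside the cell. *)
Lemma fs_cellpoint (P : {mpoly C[N]}) :
  exists (q : D -> C), S q /\ forall t, leading_minors (M t) != 0 ->
    (q t == 0) = (P.@[cellpoint (M t) 0] == 0).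
Proof.
suff [k [q [Sq qE]]] : exists k q, S q /\ forall t, leading_minors (M t) != 0 ->
    q t = leading_minors (M t) ^+ k * P.@[cellpoint (M t) 0].
  exists q; split=> // t n0; rewrite qE // mulf_eq0 expf_eq0 (negbTE n0).
  by rewrite andbF.
elim/mpoly_ring_ind: P => [c|i|f g [k [q [Sq qE]]] [l [r [Sr rE]]]|f g [k [q [Sq qE]]] [l [r [Sr rE]]]].
- exists 0%N, (fun=> c); split; first exact: fsC.
  by move=> t _; rewrite expr0 mul1r mevalC.
- pose p : lowpos n := enum_val i.
  exists 1%N, (fun t => cellnum (M t) p * \prod_(j | j != (val p).2) \det (leading j (M t))).
  split.
    apply: fsM => //; last by apply: fs_prod => // j; apply: fs_leading.
    apply: fs_sum => // k; apply: fsM => //; apply: fs_adj => // u v.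
    by apply: fs_ext (SM (widen_ord (ltn_ord (val p).2) u) (widen_ord (ltn_ord (val p).2) v)) _ => t; rewrite mxE.
  move=> t n0; rewrite mevalXU mxE -/p expr1 /leading_minors [in RHS](bigD1 (val p).2) //=.
  have /prodf_neq0/(_ (val p).2 isT) d0 := n0.
  by field.
- exists (k + l)%N, (fun t => leading_minors (M t) ^+ l * q t + leading_minors (M t) ^+ k * r t).
  split.
    by apply: fsD => //; apply: fsM => //; apply: fs_expn => //; apply: fs_leading_minors.
  by move=> t n0; rewrite qE // rE // mevalD exprD; ring.
- exists (k + l)%N, (fun t => q t * r t); split; first exact: fsM.
  by move=> t n0; rewrite qE // rE // mevalM exprD; ring.
Qed.

End CellFunctions.
End Cells.

(** * Closed sets of flags *)

Definition mpolyfun (C : comNzRingType) (N : nat) (f : 'rV[C]_N -> C) :=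
  exists p : {mpoly C[N]}, forall x, f x = p.@[x 0].

Lemma mpolyfun_subring (C : comNzRingType) (N : nat) : fun_subring (@mpolyfun C N).
Proof.
split=> [c|f g [p pE] [q qE]|f g [p pE] [q qE]].
- by exists c%:MP => x; rewrite mevalC.
- by exists (p + q) => x; rewrite pE qE mevalD.
- by exists (p * q) => x; rewrite pE qE mevalM.
Qed.

Definition polyfun (C : comNzRingType) (f : C -> C) :=
  exists p : {poly C}, forall t, f t = p.[t].

Lemma polyfun_subring (C : comNzRingType) : fun_subring (@polyfun C).
Proof.
split=> [c|f g [p pE] [q qE]|f g [p pE] [q qE]].
- by exists c%:P => x; rewrite hornerC.
- by exists (p + q) => x; rewrite pE qE hornerD.
- by exists (p * q) => x; rewrite pE qE hornerM.
Qed.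

(* For a one-parameter family over an infinite field: A t holds for infinitely
   many t. *)
Definition dense (C : nzRingType) (A : C -> Prop) :=
  forall q : {poly C}, q != 0 -> exists2 t, q.[t] != 0 & A t.

Lemma dense_nonroots (C : closedFieldType) (q : {poly C}) :
  q != 0 -> dense (fun t => q.[t] != 0).
Proof.
move=> qn0 p pn0; have pqn0 : p * q != 0 by rewrite mulf_neq0.
case: (closed_nonrootP (p * q) pqn0) => t.
by rewrite /root hornerM mulf_eq0 negb_or => /andP[pt qt]; exists t.
Qed.

Definition mxat (C : nzRingType) n (M : 'M[{poly C}]_n) (t : C) : 'M[C]_n :=
  map_mx (horner_eval t) M.

Section Varieties.
Variables (C : closedFieldType) (V : vectType C) (n : nat).
Hypothesis dimV : \dim {:V} = n.
Implicit Types (b c : n.-tuple V) (Z K : set (preflag V n)) (F : preflag V n).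
Implicit Types (g u : 'End(V)).
Local Notation N := (cell_dim n).

Lemma lowmx_mpolyfun i j : mpolyfun (fun x : 'rV[C]_N => lowmx x i j).
Proof.
have R := mpolyfun_subring C N.
apply: (@fs_ext _ _ _ (fun x : 'rV[C]_N => (i == j)%:R +
  \sum_(p : lowpos n | val p == (i, j)) x 0 (enum_rank p))) => [|x]; last by rewrite mxE.
apply: (fsD R); first exact: (fsC R).
by apply: (fs_sum R) => p; exists 'X_(enum_rank p) => x; rewrite mevalXU.
Qed.

(* The complement of the basic open set P != 0 of the big cell of b. *)
Definition outside b (P : {mpoly C[N]}) : set (preflag V n) :=
  [set F | is_flag F /\ forall x, F = flag_of (cell_basis b x) -> P.@[x 0] = 0]%classic.

(** In the cell of [b'] this set is the hypersurface [q * leading_minors = 0]: the minors vanish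
    exactly off the cell of [b], and inside it [q] has the zeros of [P]. *)
Lemma zclosed_outside b P : basis_of fullv b -> zclosed (outside b P).
Proof.
move=> bb; split=> [F [] //|b' bb'].
have R := mpolyfun_subring C N.
pose M (x : 'rV[C]_N) := coordmx b b' *m lowmx x.
have bM x : cell_basis b' x = bas b (M x).
  by rewrite cell_basisE -bas_bas bas_coordmx.
have uM x : M x \in unitmx by rewrite unitmx_mul (coordmx_unit dimV) // lowmx_unit.
have SM : forall i j, mpolyfun (fun x => M x i j).
  apply: (fs_mulmx R (A := fun=> coordmx b b') (B := @lowmx C n)) => i j.
    exact: (fsC R).
  exact: lowmx_mpolyfun.
have [q [Sq qP]] := fs_cellpoint R SM P.
have [f fE] := fsM R Sq (fs_leading_minors R SM).
exists [set f]%classic; apply/seteqP; split=> x; rewrite /cell_trace /zero_locus /=.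
  move=> [_ Px] _ ->; rewrite -fE.
  have [->|n0] := eqVneq (leading_minors (M x)) 0; first by rewrite mulr0.
  have /eqP-> : q x == 0; last by rewrite mul0r.
  by rewrite qP // Px // bM; apply: flag_cellpoint.
move=> /(_ f erefl); rewrite -fE => /eqP; rewrite mulf_eq0 => qx.
split; first by apply: flag_of_is_flag; apply: (cell_basis_basis dimV).
move=> y; rewrite bM => /(flag_in_cell dimV bb (uM x))[n0 ->].
by move: qx; rewrite (negbTE n0) orbF qP // => /eqP.
Qed.

Lemma zclosed_bigcap (J : Type) (Z : J -> set (preflag V n)) :
  J -> (forall j, zclosed (Z j)) -> zclosed [set F | forall j, Z j F]%classic.
Proof.
move=> j0 cZ; split=> [F /(_ j0)|b bb]; first exact: (cZ j0).1.
have [S SE] := choice (fun j => (cZ j).2 b bb).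
exists [set f | exists j, S j f]%classic; apply/seteqP; split=> x.
  by move=> Zx f [j Sf]; have : cell_trace b (Z j) x by []; rewrite SE; apply.
move=> H j; suff : cell_trace b (Z j) x by [].
by rewrite SE => f Sf; apply: H; exists j.
Qed.

Lemma zclosedI Z1 Z2 : zclosed Z1 -> zclosed Z2 -> zclosed (Z1 `&` Z2)%classic.
Proof.
move=> c1 c2; have := @zclosed_bigcap bool (fun j => if j then Z1 else Z2) true.
case=> [[]//|H1 H2]; suff <- : [set F | forall j : bool, (if j then Z1 else Z2) F]%classic = (Z1 `&` Z2)%classic by [].
apply/seteqP; split=> F; first by move=> H; split; [exact: (H true)|exact: (H false)].
by move=> [F1 F2] [].
Qed.

Definition act g F : preflag V n := [ffun i => (g @: F i)%VS].

Definition invertible g := lker g == 0%VS.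

Lemma act_flag_of g c : act g (flag_of c) = flag_of (map_tuple g c).
Proof. by apply/ffunP => i; rewrite !ffunE limg_span map_take. Qed.

Lemma map_cell_basis g b x : map_tuple g (cell_basis b x) = cell_basis (map_tuple g b) x.
Proof.
apply: eq_from_tnth => j; rewrite tnth_map !tnth_mktuple linearD linear_sum tnth_map.
by congr (_ + _); apply: eq_bigr => p _; rewrite linearZ tnth_map.
Qed.

Lemma map_basis g b : invertible g -> basis_of fullv b -> basis_of fullv (map_tuple g b).
Proof.
move=> ig bb; rewrite -[fullv](lker0_limgf ig); apply: limg_basis_of => //.
by rewrite (eqP ig) capv0.
Qed.

Lemma act_is_flag g F : invertible g -> is_flag F -> is_flag (act g F).
Proof.
move=> ig /(is_flag_basis dimV)[c bc ->]; rewrite act_flag_of.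
by apply: flag_of_is_flag; apply: map_basis.
Qed.

Lemma act_comp g h F : act (g \o h) F = act g (act h F).
Proof. by apply/ffunP => i; rewrite !ffunE limg_comp. Qed.

Lemma act1 F : act \1 F = F.
Proof. by apply/ffunP => i; rewrite !ffunE lim1g. Qed.

Lemma invertibleV g : invertible g -> invertible g^-1.
Proof.
move=> ig; apply/lker0P => v w E.
by rewrite -(lker0_lfunVK ig v) E lker0_lfunVK.
Qed.

Lemma actK g F : invertible g -> act g^-1 (act g F) = F.
Proof. by move=> ig; rewrite -act_comp lker0_compVf // act1. Qed.

Lemma actVK g F : invertible g -> act g (act g^-1 F) = F.
Proof. by move=> ig; rewrite -act_comp lker0_compfV // act1. Qed.

Definition preim_act g Z : set (preflag V n) := [set F | is_flag F /\ Z (act g F)]%classic.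

(** The action carries the cell of [b] to the cell of [g b] and preserves the coordinates. *)
Lemma cell_trace_preim g b Z : invertible g -> basis_of fullv b ->
  cell_trace b (preim_act g Z) = cell_trace (map_tuple g b) Z.
Proof.
move=> ig bb; apply/seteqP; split=> x; rewrite /cell_trace /preim_act /=.
  by move=> [_]; rewrite act_flag_of map_cell_basis.
rewrite -map_cell_basis -act_flag_of; split=> //.
by apply: flag_of_is_flag; apply: (cell_basis_basis dimV).
Qed.

Lemma zclosed_preim g Z : invertible g -> zclosed Z -> zclosed (preim_act g Z).
Proof.
move=> ig [_ cZ]; split=> [F [] //|b bb].
by rewrite cell_trace_preim //; apply: cZ; apply: map_basis.
Qed.

Definition represents b (g : 'End(V)) (A : 'M[C]_n) := forall a, g (vec b a) = vec b (A *m a).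

Lemma vec_surj b v : basis_of fullv b -> exists a, v = vec b a.
Proof.
move=> bb; exists (\col_i coord b i v).
rewrite {1}(coord_basis bb (memvf v)); apply: eq_bigr => i _.
by rewrite mxE (tnth_nth 0 b).
Qed.

Lemma vec_map g b a : g (vec b a) = vec (map_tuple g b) a.
Proof.
by rewrite /vec linear_sum; apply: eq_bigr => i _; rewrite linearZ tnth_map.
Qed.

Lemma represents_coordmx b g : basis_of fullv b -> represents b g (coordmx b (map_tuple g b)).
Proof. by move=> bb a; rewrite vec_map -vec_bas bas_coordmx. Qed.

Lemma represents_exists b A : basis_of fullv b -> exists g, represents b g A.
Proof.
move=> bb; pose h v := vec b (A *m \col_i coord b i v).
have hl : linear h.
  move=> k v w; rewrite /h.
  have -> : \col_i coord b i (k *: v + w) = k *: (\col_i coord b i v) + \col_i coord b i w.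
    by apply/colP => i; rewrite !mxE linearP.
  rewrite mulmxDr -scalemxAr /vec scaler_sumr -big_split /=; apply: eq_bigr => i _.
  by rewrite [X in X *: _]mxE [X in (X + _) *: _]mxE scalerDl scalerA.
pose lh := GRing.isLinear.Build C V V _ h hl.
pose H : {linear V -> V} := HB.pack h lh.
exists (linfun H) => a; rewrite lfunE /= /h; congr (vec b (A *m _)).
apply: (vec_inj bb); apply/esym; rewrite {1}/vec.
rewrite [LHS](coord_basis bb (memvf _)); apply: eq_bigr => i _.
by rewrite mxE (tnth_nth 0 b).
Qed.

Lemma map_bas b g A M : represents b g A -> map_tuple g (bas b M) = bas b (A *m M).
Proof.
move=> gA; apply: eq_from_tnth => j; rewrite tnth_map !tnth_bas gA.
by rewrite !colE mulmxA.
Qed.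

Lemma represents_invertible b g A : basis_of fullv b -> represents b g A ->
  A \in unitmx -> invertible g.
Proof.
move=> bb gA uA; apply/lker0P => v w.
have [a ->] := vec_surj v bb; have [a' ->] := vec_surj w bb.
by rewrite !gA => /(vec_inj bb) /(can_inj (mulKmx uA)) ->.
Qed.

Lemma invertible_represents b g A : basis_of fullv b -> represents b g A ->
  invertible g -> A \in unitmx.
Proof.
move=> bb gA ig; rewrite (basis_bas dimV A bb) -[A]mulmx1 -(map_bas _ gA) bas1.
exact: map_basis.
Qed.

Definition commutes g u := forall v, g (u v) = u (g v).

Lemma represents_commutes b g u A U : basis_of fullv b ->
  represents b g A -> represents b u U -> A *m U = U *m A <-> commutes g u.
Proof.
move=> bb gA uU; split=> [AU v|gu].
  by have [a ->] := vec_surj v bb; rewrite uU !gA uU !mulmxA AU.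
apply: (bas_inj bb); rewrite -(map_bas _ gA) -(map_bas _ uU).
rewrite -[A]mulmx1 -[U]mulmx1 -(map_bas _ gA) -(map_bas _ uU) bas1.
by apply: eq_from_tnth => j; rewrite !tnth_map gu.
Qed.

Lemma springer_flag_of u c : basis_of fullv c ->
  springer_fiber n u (flag_of c) <-> is_upper (coordmx c (map_tuple u c)).
Proof.
move=> bc; set U := coordmx _ _; have uU : represents c u U := represents_coordmx u bc.
have uc j : u (tnth c j) = vec c (col j U).
  by rewrite -[c in tnth c j]bas1 tnth_bas uU colE colE mul1mx.
split=> [[_ Fu] i j lt_ji|Uup].
  have : u (tnth c j) \in flag_of c (lift ord0 j).
    apply: (subvP (Fu _)); apply: memv_img; rewrite mem_flag_of; apply: memv_span.
    have ltj : (j < lift ord0 j)%N by rewrite lift0.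
    rewrite (tnth_nth 0) -(nth_take _ ltj); apply: mem_nth.
    by rewrite size_take_min size_tuple leq_min ltj ltn_ord.
  rewrite mem_flag_of uc => /span_takeP[a a0 /(vec_inj bc) aE].
  by have := a0 i; rewrite -aE mxE lift0; apply.
split=> [|k]; first exact: flag_of_is_flag.
apply/subvP => w /memv_imgP[v vF ->]; move: vF; rewrite !mem_flag_of.
move=> /span_takeP[a a0 ->]; rewrite uU; apply/span_takeP; exists (U *m a) => // i le_ki.
rewrite mxE big1 // => j _; have [le_kj|lt_jk] := leqP k j; first by rewrite a0 ?mulr0.
by rewrite Uup ?mul0r // (leq_trans lt_jk).
Qed.

Lemma zclosed_springer u : zclosed (springer_fiber n u : set (preflag V n)).
Proof.
split=> [F [] //|b bb]; have R := mpolyfun_subring C N.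
pose U := coordmx b (map_tuple u b).
(* The matrix of [u] in the basis of the cell point; [lowmx x] has determinant 1, so its inverse is
   the adjugate and is polynomial in [x]. *)
pose A (x : 'rV[C]_N) := \adj (lowmx x) *m (U *m lowmx x).
have AE x : coordmx (cell_basis b x) (map_tuple u (cell_basis b x)) = A x.
  have bc := cell_basis_basis dimV x bb.
  apply: (bas_inj bc); rewrite bas_coordmx // cell_basisE.
  rewrite (map_bas _ (represents_coordmx u bb)) bas_bas mulmxA mul_mx_adj det_lowmx.
  by rewrite mul1mx.
have SA : forall i j, mpolyfun (fun x => A x i j).
  apply: (fs_mulmx R (A := fun x => \adj (lowmx x)) (B := fun x => U *m lowmx x)).
    by apply: (fs_adj R) => i j; apply: lowmx_mpolyfun.
  apply: (fs_mulmx R (A := fun=> U) (B := @lowmx C n)) => i j.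
    exact: (fsC R).
  exact: lowmx_mpolyfun.
exists [set f | exists i j : 'I_n, (j < i)%N /\ forall x, A x i j = f.@[x 0]]%classic.
apply/seteqP; split=> x; rewrite /cell_trace /zero_locus /=.
  move/(springer_flag_of u (cell_basis_basis dimV x bb)); rewrite AE => Aup.
  by move=> f [i [j [lt_ji <-]]]; apply: Aup.
move=> H; apply/(springer_flag_of u (cell_basis_basis dimV x bb)); rewrite AE => i j lt_ji.
by have [f fE] := SA i j; rewrite fE; apply: H; exists i, j.
Qed.

Lemma springer_act u g F : invertible g -> commutes g u ->
  springer_fiber n u F -> springer_fiber n u (act g F).
Proof.
move=> ig gu [FF Fu]; split=> [|i]; first exact: act_is_flag.
rewrite ffunE -limg_comp; have -> : (u \o g = g \o u)%VF.
  by apply/lfunP => v; rewrite !comp_lfunE gu.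
by rewrite limg_comp limgS.
Qed.

(** In the cell centred at the flag for [t0], the curve stays inside for all but finitely many t.
    Each equation of [Z] pulls back, up to denominators, to a polynomial in t that vanishes too
    often to be nonzero. *)
Lemma closed_curve b Z (M : 'M[{poly C}]_n) t0 : basis_of fullv b -> zclosed Z ->
    mxat M t0 \in unitmx ->
    dense (fun t => mxat M t \in unitmx /\ Z (flag_of (bas b (mxat M t)))) ->
  Z (flag_of (bas b (mxat M t0))).
Proof.
move=> bb [_ cZ] u0 dZ; have R := polyfun_subring C.
pose b' := bas b (mxat M t0); have bb' : basis_of fullv b' by rewrite -(basis_bas dimV).
pose A t := invmx (mxat M t0) *m mxat M t.
have bA t : bas b' (A t) = bas b (mxat M t) by rewrite bas_bas mulKVmx.
have SA : forall i j, polyfun (fun t => A t i j).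
  apply: (fs_mulmx R (A := fun=> invmx (mxat M t0)) (B := mxat M)) => i j.
    exact: (fsC R).
  by exists (M i j) => t; rewrite mxE.
have [D DE] := fs_leading_minors R SA.
have Dt0 : D.[t0] != 0.
  rewrite -DE /A mulVmx //.
  have -> : 1%:M = lowmx (0 : 'rV[C]_N) *m 1%:M.
    rewrite mulmx1; apply/matrixP => i j; rewrite !mxE big1 ?addr0 // => p _.
    by rewrite mxE.
  by apply: leading_minors_lowmx; rewrite ?unitmx1 // => i j lt_ji; rewrite mxE -val_eqE gtn_eqF.
have [S SE] := cZ b' bb'.
have cellE t : D.[t] != 0 -> mxat M t \in unitmx ->
    Z (flag_of (bas b (mxat M t))) <-> zero_locus S (cellpoint (A t)).
  move=> Dt ut; rewrite -SE /cell_trace /= -flag_cellpoint ?bA ?DE //.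
  by rewrite unitmx_mul unitmx_inv u0.
apply/cellE => // f Sf.
have [q [[p pE] qP]] := fs_cellpoint R SA f.
apply/eqP; rewrite -qP ?DE // pE.
suff -> : p = 0 by rewrite horner0.
apply/eqP/negPn/negP => pn0.
have Dn0 : D != 0 by apply: contraNneq Dt0 => ->; rewrite horner0.
have [t] := dZ (p * D) (mulf_neq0 pn0 Dn0).
rewrite hornerM mulf_eq0 negb_or => /andP[pt Dt] [ut /(cellE t Dt ut)/(_ f Sf)/eqP].
by rewrite -qP ?DE // pE (negbTE pt).
Qed.

End Varieties.

(** * Action of the centralizer and degenerations *)

Lemma dense_or (C : idomainType) (A B : C -> Prop) :
  dense (fun t => A t \/ B t) -> dense A \/ dense B.
Proof.
move=> dAB; apply: contrapT => /not_orP[nA nB].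
apply: nA => p pn0; apply: contrapT => np; apply: nB => q qn0.
have [t] := dAB _ (mulf_neq0 pn0 qn0); rewrite hornerM mulf_eq0 negb_or.
move=> /andP[pt qt] [At|Bt]; last by exists t.
by case: np; exists t.
Qed.

Lemma is_upperM (R : nzRingType) n (S T : 'M[R]_n) :
  is_upper S -> is_upper T -> is_upper (S *m T).
Proof.
move=> uS uT i j lt_ji; rewrite mxE big1 // => k _.
have [lt_ki|le_ik] := ltnP k i; first by rewrite uS ?mul0r.
by rewrite uT ?mulr0 // (leq_trans lt_ji).
Qed.

Lemma is_upper1 (R : nzRingType) n : is_upper (1%:M : 'M[R]_n).
Proof. by move=> i j lt_ji; rewrite mxE -val_eqE gtn_eqF. Qed.

Lemma det_upper (R : comNzRingType) n (T : 'M[R]_n) :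
  is_upper T -> \det T = \prod_i T i i.
Proof.
move=> uT; rewrite -det_tr det_trig; first by apply: eq_bigr => i _; rewrite mxE.
by apply/is_trig_mxP => k l lt_kl; rewrite mxE uT.
Qed.

Section PolynomialMatrices.
Variables (C : fieldType) (n : nat).
Implicit Types (M N U : 'M[{poly C}]_n) (A : 'M[C]_n).

Lemma mxatM M N t : mxat (M *m N) t = mxat M t *m mxat N t.
Proof. exact: map_mxM. Qed.

Lemma mxatC A t : mxat (map_mx polyC A) t = A.
Proof. by apply/matrixP => i j; rewrite !mxE /horner_eval hornerC. Qed.

Lemma det_mxat M t : \det (mxat M t) = (\det M).[t].
Proof. exact: det_map_mx. Qed.

Lemma mxat_unit M t : (mxat M t \in unitmx) = ((\det M).[t] != 0).
Proof. by rewrite unitmxE unitfE det_mxat. Qed.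

Lemma mxat_upper U t : is_upper U -> is_upper (mxat U t).
Proof. by move=> uU i j /uU; rewrite mxE => ->; rewrite /horner_eval horner0. Qed.

(* The valuative criterion of properness for the flag variety: a curve of flags
   defined for t != 0 extends to t = 0.  When the columns of M(0) are
   dependent, the last column in a relation is replaced by the relation divided
   by t, which lowers the order of vanishing of det M. *)
Lemma saturate M : \det M != 0 ->
  exists N U, [/\ is_upper U, M = N *m U & mxat N 0 \in unitmx].
Proof.
have [m] := ubnP (size (\det M)); elim: m M => // m IHm M szM dM.
have [d0|] := eqVneq (\det M).[0] 0; last first.
  by move=> d0; exists M, 1%:M; rewrite mxat_unit mulmx1; split=> //; apply: is_upper1.
have : \det (mxat M 0)^T == 0 by rewrite det_tr det_mxat d0.
case/det0P => v vn0 vM.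
have [i0 vi0] : exists i, v 0 i != 0.
  apply/existsP; apply: contraNT vn0; rewrite negb_exists => /forallP v0.
  by apply/eqP/rowP => i; rewrite mxE; apply/eqP; have := v0 i; rewrite negbK.
case: (@arg_maxnP _ i0 (fun i => v 0 i != 0) val vi0) => j vj jmax.
pose w i := v 0 i / v 0 j.
have wj : w j = 1 by rewrite /w divff.
have w0 (i : 'I_n) : (j < i)%N -> w i = 0.
  move=> lt_ji; rewrite /w; have [->|vi] := eqVneq (v 0 i) 0; first by rewrite mul0r.
  by have := jmax i vi; rewrite /geq /= leqNgt lt_ji.
have yex i : exists y, \sum_l M i l * (w l)%:P = y * 'X.
  have : root (\sum_l M i l * (w l)%:P) 0.
    rewrite /root horner_sum.
    have /rowP/(_ i) := vM; rewrite mxE [RHS]mxE => E.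
    rewrite (eq_bigr (fun l => v 0 l * (mxat M 0)^T l i / v 0 j)).
      by rewrite -mulr_suml E mul0r.
    by move=> l _; rewrite hornerM hornerC !mxE /horner_eval /w mulrCA mulrA.
  by case/factor_theorem => y; rewrite subr0; exists y.
have [y yE] := choice yex.
pose N : 'M[{poly C}]_n := \matrix_(i, k) if k == j then y i else M i k.
(* The j-th column encodes the relation solved for [M_j]: it equals ['X N_j] minus the sum of the
   [w_i M_i] for i different from j. The choice of j as the last index involved makes [U] upper
   triangular. *)
pose U : 'M[{poly C}]_n := \matrix_(i, k)
  if k == j then (if i == j then 'X else - (w i)%:P) else (i == k)%:R.
have uU : is_upper U.
  move=> i k lt_ki; rewrite mxE; case: eqP => [kj|_].
    by rewrite -val_eqE -kj gtn_eqF // w0 ?oppr0 // -kj.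
  by rewrite -val_eqE gtn_eqF.
have MNU : M = N *m U.
  apply/matrixP => i k; rewrite !mxE; have [->|nkj] := eqVneq k j; last first.
    rewrite (bigD1 k) //= !mxE (negbTE nkj) eqxx mulr1 big1 ?addr0 // => l nlk.
    by rewrite !mxE (negbTE nkj) (negbTE nlk) mulr0.
  rewrite (bigD1 j) //= !mxE !eqxx -yE (bigD1 j) //= wj mulr1 -addrA -big_split /=.
  rewrite big1 ?addr0 // => l nlj.
  by rewrite !mxE (negbTE nlj) eqxx mulrN subrr.
have detU : \det U = 'X.
  rewrite (det_upper uU) (bigD1 j) //= mxE !eqxx big1 ?mulr1 // => l nlj.
  by rewrite mxE (negbTE nlj) eqxx.
have dN : \det N != 0.
  by apply: contraNneq dM; rewrite MNU det_mulmx => ->; rewrite mul0r.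
have [|N' [U' [uU' NE uN']]] := IHm N _ dN.
  by move: szM; rewrite MNU det_mulmx detU size_mulX.
by exists N', (U' *m U); split=> //; [apply: is_upperM | rewrite mulmxA -NE].
Qed.

End PolynomialMatrices.

Section Stability.
Variables (C : closedFieldType) (V : vectType C) (n : nat).
Hypothesis dimV : \dim {:V} = n.
Variables (e : n.-tuple V) (u : 'End(V)).
Hypothesis be : basis_of fullv e.
Implicit Types (Z K : set (preflag V n)) (M A : 'M[C]_n).

Lemma act_bas (g : 'End(V)) A M : represents e g A ->
  act g (flag_of (bas e M)) = flag_of (bas e (A *m M)).
Proof. by move=> gA; rewrite act_flag_of (map_bas _ gA). Qed.

Lemma flag_basP (F : preflag V n) : is_flag F ->
  exists2 M, M \in unitmx & F = flag_of (bas e M).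
Proof.
move=> /(is_flag_basis dimV)[c bc ->]; exists (coordmx e c).
  exact: coordmx_unit.
by rewrite bas_coordmx.
Qed.

(* The centralizer of u is connected: g is joined to 1 by the line
   t |-> 1 + t (g - 1), and the translates of K along this line sweep out an
   irreducible subset of the Springer fiber. *)
Lemma component_stable K (g : 'End(V)) F :
  irreducible_component (springer_fiber n u) K -> invertible g -> commutes g u ->
  K F -> K (act g F).
Proof.
move=> [cK [[F0 KF0] irrK] KX Kmax] ig gu KF.
pose U := coordmx e (map_tuple u e); have uU : represents e u U := represents_coordmx u be.
pose G := coordmx e (map_tuple g e); have gG : represents e g G := represents_coordmx g be.
pose P : 'M[{poly C}]_n := 1%:M + 'X *: map_mx polyC (G - 1%:M).
have PE t : mxat P t = 1%:M + t *: (G - 1%:M).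
  apply/matrixP => i j; rewrite !mxE /horner_eval hornerD hornerM hornerX hornerC.
  by congr (_ + _); case: (i == j); rewrite ?hornerC ?horner0.
have P0 : mxat P 0 = 1%:M by rewrite PE scale0r addr0.
have P1 : mxat P 1 = G by rewrite PE scale1r addrC subrK.
have dP : \det P != 0.
  apply: contraTneq (unitmx1 C n) => d0.
  by rewrite -P0 mxat_unit d0 horner0 eqxx.
have [h hP] := choice (fun t => represents_exists (mxat P t) be).
have hu t : commutes (h t) u.
  apply/(represents_commutes be (hP t) uU); rewrite PE mulmxDl mulmxDr.
  rewrite mul1mx mulmx1 -scalemxAl -scalemxAr mulmxBl mulmxBr mul1mx mulmx1.
  by have /(represents_commutes be gG uU) -> := gu.
have ih t : mxat P t \in unitmx -> invertible (h t).
  by move=> ut; apply: represents_invertible (hP t) ut.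
pose O : set (preflag V n) :=
  [set F' | exists t F, [/\ mxat P t \in unitmx, K F & F' = act (h t) F]]%classic.
have KO : (K `<=` O)%classic.
  move=> F1 KF1; exists 0, F1; split=> //; first by rewrite P0 unitmx1.
  have [M uM ->] := flag_basP (cK.1 _ KF1).
  by rewrite (act_bas _ (hP 0)) P0 mul1mx.
have OX : (O `<=` springer_fiber n u)%classic.
  by move=> _ [t [F1 [ut KF1 ->]]]; apply: springer_act => //; [apply: ih | apply: KX].
have irrO Z1 Z2 : zclosed Z1 -> zclosed Z2 -> (O `<=` Z1 `|` Z2)%classic ->
    (O `<=` Z1)%classic \/ (O `<=` Z2)%classic.
  move=> c1 c2 O12.
  (* Following a single flag of [K] along the line: membership in [Z] for a dense set of t extends
     to every t where [P] is invertible. *)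
  have half Z : zclosed Z ->
      dense (fun t => mxat P t \in unitmx /\ (K `<=` preim_act (h t) Z)%classic) ->
      (O `<=` Z)%classic.
    move=> cZ dZ _ [t [F1 [ut KF1 ->]]].
    have [M uM FM] := flag_basP (cK.1 _ KF1).
    have QE t1 : mxat (P *m map_mx polyC M) t1 = mxat P t1 *m M.
      by rewrite mxatM mxatC.
    rewrite FM (act_bas _ (hP t)) -QE; apply: closed_curve => //.
      by rewrite QE unitmx_mul ut.
    move=> q /dZ[t1 qt1 [ut1 Kt1]]; exists t1 => //.
    rewrite QE unitmx_mul ut1 uM -(act_bas _ (hP t1)) -FM; split=> //.
    by have [] := Kt1 _ KF1.
  (* Each translate of [K] is irreducible, hence inside [Z1] or inside [Z2]; one alternative must
     occur for a dense set of t. *)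
  have /dense_or[] : dense (fun t =>
      (mxat P t \in unitmx /\ (K `<=` preim_act (h t) Z1)%classic) \/
      (mxat P t \in unitmx /\ (K `<=` preim_act (h t) Z2)%classic)).
  - move=> q /(dense_nonroots dP)[t]; rewrite -mxat_unit => qt ut; exists t => //.
    have it := ih t ut.
    have [||F1 KF1|K1|K2] := irrK (preim_act (h t) Z1) (preim_act (h t) Z2).
    + exact: zclosed_preim.
    + exact: zclosed_preim.
    + have FF1 := cK.1 _ KF1.
      have [|Z1F|Z2F] := O12 (act (h t) F1); first by exists t, F1.
      - by left.
      - by right.
    + by left.
    + by right.
  - by left; apply: half.
  - by right; apply: half.
pose J := {Z : set (preflag V n) | zclosed Z /\ (O `<=` Z)%classic}.
(* The Zariski closure of [O]; it is irreducible and contains [K], so maximality gives [K' = K]. *)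
pose K' : set (preflag V n) := [set F | forall Z : J, sval Z F]%classic.
have OK' : (O `<=` K')%classic by move=> F1 OF1 [Z [cZ OZ]]; apply: OZ.
pose jX : J := exist _ _ (conj (zclosed_springer dimV u) OX).
have cK' : zclosed K' by apply: (zclosed_bigcap jX) => -[Z [cZ OZ]].
have irrK' : zirreducible K'.
  split; first by exists F0; apply/OK'/KO.
  move=> Z1 Z2 c1 c2 K12.
  have sub Z : zclosed Z -> (O `<=` Z)%classic -> (K' `<=` Z)%classic.
    by move=> cZ OZ F1 /(_ (exist _ Z (conj cZ OZ))).
  by case: (irrO Z1 Z2 c1 c2) => [F1 /OK'/K12 //|H|H]; [left|right]; apply: sub.
have K'X : (K' `<=` springer_fiber n u)%classic by move=> F1 /(_ jX).
have <- : K' = K.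
  apply: (Kmax K' cK' irrK' K'X) => F1 KF1.
  by apply: OK'; apply: KO.
apply: OK'; exists 1, F; rewrite P1; split=> //.
  exact: (invertible_represents dimV be gG).
have [M uM ->] := flag_basP (cK.1 _ KF).
by rewrite (act_bas _ gG) (act_bas _ (hP 1)) P1.
Qed.

Hypotheses (r : nat) (r_gt0 : (0 < r)%N) (le_n2r : (n <= r + r)%N).
Let U : 'M[C]_n := \matrix_(i, j) (val j == val i + r)%N%:R.
Hypothesis uU : represents e u U.

Definition stable Z := forall (g : 'End(V)) F,
  invertible g -> commutes g u -> Z F -> Z (act g F).

Definition upper_until k M :=
  forall i j : 'I_n, (j < k)%N -> (j < i)%N -> M i j = 0.

(** Entrywise, [A U] shifts columns by r and [U A] shifts rows by r, so commutation of a 0-1 matrix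
    with [U] becomes arithmetic on indices. *)
Lemma commute_matrix (f : nat -> nat -> bool) (A := \matrix_(p, q) (f p q)%:R : 'M[C]_n) :
    (forall p q, (p < n)%N -> (q < n)%N ->
       ((r <= q)%N && f p (q - r)%N) = ((p + r < n)%N && f (p + r)%N q)) ->
  A *m U = U *m A.
Proof.
move=> fE; apply/matrixP => p q; rewrite !mxE.
transitivity (((r <= q)%N && f p (q - r)%N)%:R : C).
  have [le_rq|lt_qr] := leqP r q; last first.
    rewrite big1 // => m _; rewrite !mxE (_ : (_ == _) = false) ?mulr0 //.
    by apply/negbTE; apply: contraL lt_qr => /eqP ->; rewrite -leqNgt leq_addl.
  have ltq : (q - r < n)%N by rewrite (leq_ltn_trans (leq_subr _ _)).
  rewrite (bigD1 (Ordinal ltq)) //= !mxE /= subnK // eqxx mulr1 big1 ?addr0 //.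
  move=> m nm; rewrite !mxE (_ : (_ == _) = false) ?mulr0 //; apply/negbTE.
  by apply: contra nm => /eqP E; rewrite -val_eqE /= [nat_of_ord q]E addnK.
rewrite fE //; have [ltp|gep] := ltnP (p + r) n; last first.
  rewrite big1 // => m _; rewrite !mxE (_ : (_ == _) = false) ?mul0r //.
  by apply/negbTE; rewrite neq_ltn (leq_trans (ltn_ord m)).
rewrite (bigD1 (Ordinal ltp)) //= !mxE /= eqxx mul1r big1 ?addr0 //.
move=> m nm; rewrite !mxE (_ : (_ == _) = false) ?mul0r //; apply/negbTE.
by apply: contra nm => /eqP E; rewrite -val_eqE /= E.
Qed.

(* The limit as t -> 0 of the translates by t + A, where A commutes with u. *)
Lemma degenerate_step Z M A (k : 'I_n) :
    zclosed Z -> stable Z -> M \in unitmx -> Z (flag_of (bas e M)) ->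
    upper_until k M -> is_upper A -> A *m U = U *m A ->
    (A *m M) k k != 0 -> (forall i : 'I_n, (k < i)%N -> (A *m M) i k = 0) ->
  exists2 M', M' \in unitmx & Z (flag_of (bas e M')) /\ upper_until k.+1 M'.
Proof.
move=> cZ sZ uM ZM upM upA AU Akk Aik.
pose P := ('X%:M + map_mx polyC A) *m map_mx polyC M.
have PE t : mxat P t = (t%:M + A) *m M.
  rewrite mxatM mxatC; congr (_ *m _); apply/matrixP => i j.
  by rewrite !mxE /horner_eval hornerD hornerC hornerMn hornerX.
have dP : \det P != 0.
  rewrite det_mulmx mulf_neq0 //.
    have -> : 'X%:M + map_mx polyC A = char_poly_mx (- A).
      by rewrite /char_poly_mx map_mxN opprK.
    exact/monic_neq0/char_poly_monic.
  by rewrite det_map_mx polyC_eq0 -unitfE -unitmxE.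
(* [P] may degenerate at t = 0; [N] gives the same flags where [P] is invertible and stays
   invertible at 0. *)
have [N [T [upT PNT uN]]] := saturate dP.
have TN0 j : T j j != 0.
  have := dP; rewrite PNT det_mulmx (det_upper upT) mulf_eq0 negb_or => /andP[_].
  by move/prodf_neq0; apply.
have uNt t : mxat P t \in unitmx -> mxat N t \in unitmx.
  by rewrite PNT mxatM unitmx_mul => /andP[].
exists (mxat N 0) => //; split.
  apply: (closed_curve dimV) => // q /(dense_nonroots dP)[t]; rewrite -mxat_unit => qt ut.
  exists t => //; split; first exact: uNt.
  have -> : flag_of (bas e (mxat N t)) = flag_of (bas e (mxat P t)).
    apply/esym/(flag_upperP dimV) => //; first exact: uNt.
    by exists (mxat T t); [apply: mxat_upper | rewrite -mxatM -PNT].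
  have [h hE] := represents_exists (t%:M + A) be.
  rewrite PE -(act_bas _ hE); apply: sZ => //.
    apply: (represents_invertible be hE).
    by move: ut; rewrite PE unitmx_mul => /andP[].
  apply/(represents_commutes be hE uU).
  by rewrite mulmxDl mulmxDr AU scalar_mxC.
have upP (i j : 'I_n) : (j < k)%N -> (j < i)%N -> P i j = 0.
  move=> lt_jk lt_ji; rewrite mxE big1 // => l _; rewrite !mxE.
  have [le_li|lt_il] := leqP i l; first by rewrite upM ?mulr0 // (leq_trans lt_ji).
  by rewrite upA // -val_eqE gtn_eqF // addr0 mulr0n mul0r.
have upN (i j : 'I_n) : (j < k)%N -> (j < i)%N -> N i j = 0.
  have [m] := ubnP (val j); elim: m j => // m IHm j lt_jm lt_jk lt_ji.
  have := upP i j lt_jk lt_ji; rewrite PNT mxE (bigD1 j) //= big1 ?addr0.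
    by move/eqP; rewrite mulf_eq0 (negbTE (TN0 j)) orbF => /eqP.
  move=> l nlj; have [lt_lj|le_jl] := ltnP l j.
    by rewrite (IHm l (leq_trans lt_lj lt_jm) (ltn_trans lt_lj lt_jk) (ltn_trans lt_lj lt_ji)) mul0r.
  by rewrite upT ?mulr0 // ltn_neqAle le_jl andbT eq_sym.
have up0 (i j : 'I_n) : (j < k)%N -> (j < i)%N -> mxat N 0 i j = 0.
  by move=> lt_jk lt_ji; rewrite mxE upN // /horner_eval horner0.
(* At t = 0 one has [A M = N(0) T(0)]. In rows from k on, the earlier columns of [N(0)] vanish, so
   its k-th column is proportional to that of [A M], with a factor that the nonzero entry
   [(A M) k k] keeps nonzero. *)
have colk (i : 'I_n) : (k <= i)%N -> (A *m M) i k = mxat N 0 i k * mxat T 0 k k.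
  move=> le_ki; have := congr1 (fun B : 'M_n => B i k) (mxatM N T 0).
  rewrite -PNT PE raddf0 add0r /= => ->; rewrite mxE (bigD1 k) //= big1 ?addr0 // => l nlk.
  have [lt_lk|le_kl] := ltnP l k.
    by rewrite up0 ?mul0r // (leq_trans lt_lk).
  by rewrite (mxat_upper 0 upT) ?mulr0 // ltn_neqAle le_kl andbT eq_sym.
have Tk : mxat T 0 k k != 0.
  by apply: contraNneq Akk => T0; rewrite colk // T0 mulr0.
move=> i j; rewrite ltnS leq_eqVlt => /predU1P[|lt_jk]; last exact: up0.
move/val_inj => -> lt_ki; have := Aik i lt_ki; rewrite colk ?(ltnW lt_ki) // => /eqP.
by rewrite mulf_eq0 (negbTE Tk) orbF => /eqP.
Qed.

Lemma upper_until_nonzero M (k : 'I_n) : M \in unitmx -> upper_until k M ->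
  exists2 i : 'I_n, (k <= i)%N & M i k != 0.
Proof.
move=> uM upM; apply: contrapT => H.
have M0 (i : 'I_n) : (k <= i)%N -> M i k = 0.
  by move=> le_ki; apply/eqP/negPn/negP => ni; apply: H; exists i.
have bM : basis_of fullv (bas e M) by rewrite -(basis_bas dimV).
suff /dimvS : (<<take k.+1 (bas e M)>> <= <<take k e>>)%VS.
  by rewrite !dim_span_take // ?ltnn // ltnW.
apply/subvP => v /span_takeP[a a0 ->]; rewrite vec_bas; apply/span_takeP.
exists (M *m a) => // i le_ki; rewrite mxE big1 // => j _.
have [lt_kj|le_jk] := ltnP k j; first by rewrite a0 ?mulr0.
have [lt_jk|le_kj] := ltnP j k; first by rewrite upM ?mul0r // (leq_trans lt_jk).
have -> : j = k by apply/val_inj/eqP; rewrite eqn_leq le_jk.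
by rewrite M0 ?mul0r.
Qed.

(* A moves the k-th vector of the flag onto e_k, along a matrix unit (or a pair
   of matrix units) commuting with u. *)
Lemma degenerate_column Z M (k : 'I_n) :
    zclosed Z -> stable Z -> M \in unitmx -> Z (flag_of (bas e M)) ->
    upper_until k M ->
  exists2 M', M' \in unitmx & Z (flag_of (bas e M')) /\ upper_until k.+1 M'.
Proof.
move=> cZ sZ uM ZM upM.
have step (f : nat -> nat -> bool) (i : 'I_n) : M i k != 0 ->
    (forall p q, f p q -> (p <= q)%N) ->
    (forall p q, (p < n)%N -> (q < n)%N ->
       ((r <= q)%N && f p (q - r)%N) = ((p + r < n)%N && f (p + r)%N q)) ->
    (forall q : nat, f k q = (q == i)) ->
    (forall p q : 'I_n, (k < p)%N -> f p q -> M q k = 0) ->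
    exists2 M', M' \in unitmx & Z (flag_of (bas e M')) /\ upper_until k.+1 M'.
  move=> Mik fup fcomm fk fp; pose A : 'M[C]_n := \matrix_(p, q) (f p q)%:R.
  apply: (@degenerate_step Z M A k) => //.
  - move=> p q lt_qp; rewrite mxE; case E: (f p q) => //.
    by have := fup _ _ E; rewrite leqNgt lt_qp.
  - exact: commute_matrix.
  - rewrite mxE (bigD1 i) //= mxE fk eqxx mul1r big1 ?addr0 // => q nqi.
    by rewrite mxE fk val_eqE (negbTE nqi) mul0r.
  - move=> p lt_kp; rewrite mxE big1 // => q _; rewrite mxE.
    by case E: (f p q); rewrite ?mul0r // (fp p q) ?mulr0.
have [i le_ki Mik] := upper_until_nonzero uM upM.
have ltk := ltn_ord k; have lti := ltn_ord i.
have [le_rk|lt_kr] := leqP r k.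
  (* Case k >= r: [A] sends [e_i] to [e_k], hence must send [u(e_i)] to [u(e_k)]. *)
  apply: (step (fun p q => (p == k)%N && (q == i)%N || (p + r == k)%N && (q + r == i)%N) i) => //.
  - by move=> p q; lia.
  - by move=> p q ltp ltq; lia.
  - by move=> q; lia.
  - by move=> p q lt_kp; lia.
case: (pselect (exists2 j : 'I_n, (r <= j)%N & M j k != 0)) => [[j le_rj Mjk]|nj].
  have ltj := ltn_ord j.
  (* Here [e_k] is killed by [u], and [e_j] does not occur in the image of [u], so one matrix unit
     commutes with [u]. *)
  apply: (step (fun p q => (p == k)%N && (q == j)%N) j) => //.
  - by move=> p q; lia.
  - by move=> p q ltp ltq; lia.
  - by move=> q; rewrite eqxx.
  - by move=> p q lt_kp; lia.
have M0 (j : 'I_n) : (r <= j)%N -> M j k = 0.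
  by move=> le_rj; apply/eqP/negPn/negP => nz; apply: nj; exists j.
have lt_ir : (i < r)%N.
  by rewrite ltnNge; apply/negP => le_ri; rewrite M0 ?eqxx in Mik.
(* Now [e_i] may lie in the image of [u], which forces a second unit in row k + r; it does no harm,
   since the column has no entries from row r on. *)
apply: (step (fun p q => (p == k)%N && (q == i)%N || (p == k + r)%N && (q == i + r)%N) i) => //.
- by move=> p q; lia.
- by move=> p q ltp ltq; lia.
- by move=> q; lia.
- by move=> p q lt_kp fpq; apply: M0; lia.
Qed.

Lemma closed_stable_flag Z F : zclosed Z -> stable Z -> Z F -> Z (flag_of e).
Proof.
move=> cZ sZ ZF.
have H k : (k <= n)%N ->
    exists2 M, M \in unitmx & Z (flag_of (bas e M)) /\ upper_until k M.
  elim: k => [_|k IHk lt_kn].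
    have [M uM FM] := flag_basP (cZ.1 _ ZF); exists M => //.
    by rewrite -FM.
  have [M uM [ZM upM]] := IHk (ltnW lt_kn).
  exact: (@degenerate_column Z M (Ordinal lt_kn)).
have [M uM [ZM upM]] := H n (leqnn n); rewrite -[e]bas1.
suff -> : flag_of (bas e 1%:M) = flag_of (bas e M) by [].
apply/esym/(flag_upperP dimV) => //; first exact: unitmx1.
by exists M => [i j|]; [apply: upM | rewrite mul1mx].
Qed.

End Stability.

(** * Components of the Springer fiber *)

Section Components.
Variables (C : closedFieldType) (V : vectType C) (n : nat).
Hypothesis dimV : \dim {:V} = n.
Implicit Types (b c : n.-tuple V) (K Z : set (preflag V n)) (F : preflag V n).
Local Notation N := (cell_dim n).

Lemma outsideP b (P : {mpoly C[N]}) F : is_flag F -> ~ outside b P F ->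
  exists2 x, F = flag_of (cell_basis b x) & P.@[x 0] != 0.
Proof.
move=> FF nF; apply: contrapT => H; apply: nF; split=> // x Fx.
by apply/eqP/negPn/negP => Px; apply: H; exists x.
Qed.

(** If [f * g] vanishes on the trace, the closed sets [outside b f] and [outside b g] cover [K]. *)
Lemma vanishing_ideal_prime b K : basis_of fullv b -> zclosed K -> zirreducible K ->
  (exists x, cell_trace b K x) -> prime_ideal (vanishing_ideal (cell_trace b K)).
Proof.
move=> bb cK [_ irrK] [x0 Kx0]; split.
- by move=> x _; rewrite meval0.
- by move=> f g If Ig x Kx; rewrite mevalD If // Ig // addr0.
- by move=> f g Ig x Kx; rewrite mevalM Ig // mulr0.
- by move=> /(_ x0 Kx0)/eqP; rewrite meval1 oner_eq0.
move=> f g Ifg.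
have sub h : (K `<=` outside b h)%classic -> vanishing_ideal (cell_trace b K) h.
  by move=> Kh x /Kh [_]; apply.
have [||F KF|/sub|/sub] := irrK (outside b f) (outside b g); [| | |by left|by right].
- exact: zclosed_outside.
- exact: zclosed_outside.
have FF : is_flag F by apply: cK.1.
have [|/(outsideP FF)[x Fx fx]] := pselect (outside b f F); [by left | right].
split=> // y; rewrite Fx => /(flag_cell_inj dimV bb) <-.
have : (f * g).@[x 0] = 0 by apply: Ifg; rewrite /cell_trace /= -Fx.
by rewrite mevalM => /eqP; rewrite mulf_eq0 (negbTE fx) => /eqP.
Qed.

(** Otherwise [K] would be covered by [Z] and [outside b 1], the complement of the cell;
    irreducibility excludes this once the cell meets [K]. *)
Lemma cell_trace_proper b Z K : basis_of fullv b -> zclosed Z -> zirreducible K ->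
    zclosed K -> (exists x, cell_trace b K x) -> ~ (K `<=` Z)%classic ->
  exists2 f, vanishing_ideal (cell_trace b Z) f
           & ~ vanishing_ideal (cell_trace b K) f.
Proof.
move=> bb cZ [_ irrK] cK [x0 Kx0] nKZ; apply: contrapT => H.
have [S SE] := cZ.2 b bb.
have KZ x : cell_trace b K x -> cell_trace b Z x.
  move=> Kx; rewrite SE => f Sf; apply: contrapT => nf; apply: H; exists f.
    by move=> y; rewrite SE; apply.
  by move/(_ x Kx).
have [||F KF|//|K1] := irrK Z (outside b 1) => //; first exact: zclosed_outside.
  have FF : is_flag F by apply: cK.1.
  have [|/(outsideP FF)[x Fx _]] := pselect (outside b 1 F); [by right | left].
  by rewrite Fx; apply: KZ; rewrite /cell_trace /= -Fx.
have [_ /(_ x0 erefl)/eqP] := K1 _ Kx0.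
by rewrite meval1 oner_eq0.
Qed.

(** A chain of maximal length ends at [K], since otherwise [K] could be appended. *)
Lemma has_zdim_chain K d : zclosed K -> zirreducible K -> has_zdim K d ->
  exists Z : nat -> set (preflag V n),
    [/\ forall i, (i <= d)%N -> zclosed (Z i) /\ zirreducible (Z i),
        forall i, (i < d)%N -> (Z i `<` Z i.+1)%classic & Z d = K].
Proof.
move=> cK irrK [[Z [ZP Zlt]] dmax]; exists Z; split=> //.
  by move=> i /ZP[].
have [_ _ ZdK] := ZP d (leqnn d).
apply: contrapT => nZK; suff /dmax : irr_chain K d.+1 by rewrite ltnn.
exists (fun i => if (i <= d)%N then Z i else K); split=> i.
  by move=> _; case: leqP => [/ZP//|_]; split.
rewrite ltnS; case: ltngtP => // [lt_id _|-> _]; first exact: Zlt.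
split=> // KZd; apply: nZK.
by apply/seteqP; split.
Qed.

(** The chain bound holds at some point [z] of the open set where semicontinuity compares [z] with
    [x]. The cell must meet [Z 0] for the whole chain to survive in it. *)
Lemma zdim_le_tangent_dim (char0 : [pchar C] =i pred0) b K d
    (Z : nat -> set (preflag V n)) (x : 'rV[C]_N) (T : {vspace 'rV[C]_N}) :
    basis_of fullv b ->
    (forall i, (i <= d)%N -> zclosed (Z i) /\ zirreducible (Z i)) ->
    (forall i, (i < d)%N -> (Z i `<` Z i.+1)%classic) -> Z d = K ->
    (exists y, cell_trace b (Z 0%N) y) ->
    cell_trace b K x -> (forall v, v \in T <-> tangent (cell_trace b K) x v) ->
  (d <= \dim T)%N.
Proof.
move=> bb ZP Zlt <- [y Z0y] Kx TE.
have Zy i : (i <= d)%N -> cell_trace b (Z i) y.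
  elim: i => // i IHi lt_id; have [sub _] := Zlt i lt_id.
  exact/sub/IHi/ltnW.
have [P Px Pdim] := tangent_upper_semicontinuous TE.
have [||||z [Kz Pz dz]] := @chain_le_tangent_dim C N char0 (fun i => cell_trace b (Z i)) d P.
- move=> i le_id; have [cZ irrZ] := ZP i le_id.
  by apply: vanishing_ideal_prime => //; exists y; apply: Zy.
- by move=> i lt_id w; have [sub _] := Zlt i lt_id; apply: sub.
- move=> i lt_id; have [cZ irrZ] := ZP _ lt_id; have [_ nsub] := Zlt i lt_id.
  apply: cell_trace_proper => //; first by case: (ZP i (ltnW lt_id)).
  by exists y; apply: Zy.
- by move=> /(_ x Kx)/eqP; rewrite (negbTE Px).
have [T' T'E] := tangent_vspace (cell_trace b (Z d)) z.
exact: leq_trans (dz _ T'E) (Pdim _ _ Pz T'E).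
Qed.

Variables (e : n.-tuple V) (u : 'End(V)) (r : nat).
Hypotheses (be : basis_of fullv e) (r_gt0 : (0 < r)%N) (le_n2r : (n <= r + r)%N).
Hypothesis uU : represents e u (\matrix_(i, j) (val j == val i + r)%N%:R).

Section Component.
Variable K : set (preflag V n).
Hypothesis KX : irreducible_component (springer_fiber n u) K.

Lemma component_flag : K (flag_of e).
Proof.
have [cK [[F KF] _] _ _] := KX.
apply: (closed_stable_flag dimV be r_gt0 le_n2r uU cK _ KF).
by move=> g F' ig gu; apply: (component_stable dimV be KX).
Qed.

(** The flags of [K] all of whose translates avoid the open set [P != 0] form a closed stable set;
    if nonempty it would contain [flag_of e], which lies in that open set. *)
Lemma move_to_cell b (P : {mpoly C[N]}) x0 F : basis_of fullv b ->
    flag_of e = flag_of (cell_basis b x0) -> P.@[x0 0] != 0 -> K F ->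
  exists g, [/\ invertible g, commutes g u &
    exists2 x, act g F = flag_of (cell_basis b x) & P.@[x 0] != 0].
Proof.
move=> bb eE Px0 KF; apply: contrapT => H; have [cK _ _ _] := KX.
pose J := {g : 'End(V) | invertible g /\ commutes g u}.
have i1 : invertible (\1 : 'End(V)) by apply/lker0P => v w; rewrite !lfunE.
have c1 : commutes \1 u by move=> v; rewrite !lfunE.
pose S : set (preflag V n) :=
  (K `&` [set F | forall g : J, preim_act (sval g) (outside b P) F])%classic.
have cS : zclosed S.
  apply: zclosedI => //; apply: (zclosed_bigcap (exist _ _ (conj i1 c1) : J)) => -[g [ig gu]].
  by apply: (zclosed_preim dimV ig); apply: (zclosed_outside dimV).
have sS : stable u S.
  move=> h F1 ih hu [KF1 outF1]; split; first exact: (component_stable dimV be KX).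
  move=> [g [ig gu]]; split; first by apply: (act_is_flag dimV ih); apply: cK.1.
  have igh : invertible (g \o h)%VF.
    by apply/lker0P => v w; rewrite !comp_lfunE => /(elimT lker0P ig)/(elimT lker0P ih).
  have cgh : commutes (g \o h)%VF u by move=> v; rewrite !comp_lfunE hu gu.
  by have [_] := outF1 (exist _ _ (conj igh cgh)); rewrite /= act_comp.
have SF : S F.
  split=> // -[g [ig gu]]; have FF := cK.1 _ KF; split=> //; apply: contrapT.
  move=> /(outsideP (act_is_flag dimV ig FF)) ex; apply: H; exists g; split=> //.
have [_ /(_ (exist _ _ (conj i1 c1)))[_ /=]] := closed_stable_flag dimV be r_gt0 le_n2r uU cS sS SF.
by rewrite act1 => -[_ /(_ x0 eE)/eqP]; rewrite (negbTE Px0).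
Qed.

Lemma cell_trace_act g b : invertible g -> commutes g u -> basis_of fullv b ->
  cell_trace (map_tuple g^-1%VF b) K = cell_trace b K.
Proof.
move=> ig gu bb; have igV := invertibleV ig.
have [cK _ _ _] := KX.
rewrite -(cell_trace_preim dimV _ igV bb); congr cell_trace.
apply/seteqP; split=> F.
  move=> [_ KgF]; rewrite -(actVK F ig).
  exact: (component_stable dimV be KX).
move=> KF; split; first exact: cK.1.
apply: (component_stable dimV be KX) => // v.
by rewrite -{1}(lker0_lfunVK ig v) -gu (lker0_lfunK ig).
Qed.

Lemma nonsingular_component (char0 : [pchar C] =i pred0) :
  nonsingular_at K (flag_of e) -> nonsingular K.
Proof.
move=> [_ [b [x0 [T0 [bb eE T0E dimK]]]]] F KF; have [cK irrK _ _] := KX.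
have [P Px0 Pdim] := tangent_upper_semicontinuous T0E.
have [g [ig gu [x gFx Px]]] := move_to_cell bb eE Px0 KF.
have Kx : cell_trace b K x.
  by rewrite /cell_trace /= -gFx; apply: (component_stable dimV be KX).
have [T TE] := tangent_vspace (cell_trace b K) x.
have dT : \dim T = \dim T0.
  apply/eqP; rewrite eqn_leq (Pdim _ _ Px TE) /=.
  have [Z [ZP Zlt Zd]] := has_zdim_chain cK irrK dimK.
  have [cZ0 [[F0 ZF0] _]] := ZP 0%N (leq0n _).
  have KF0 : K F0.
    rewrite -Zd; elim: (\dim T0) Zlt {Pdim ZP Zd dimK} => // d IHd Zlt.
    have [sub _] := Zlt d (ltnSn d); apply/sub/IHd => i lt_id.
    by apply: Zlt; apply: ltnW.
  (* The cell of [b] may miss [Z 0]. With [P = 1] the lemma only brings a flag of [Z 0] into the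
     cell; translating the cell back by [h^-1] leaves the trace of [K], and so [x] and [T],
     unchanged. *)
  have one0 : (1 : {mpoly C[N]}).@[x0 0] != 0 by rewrite meval1 oner_eq0.
  have [h [ih hu [y hFy _]]] := move_to_cell bb eE one0 KF0.
  have bh : basis_of fullv (map_tuple h^-1%VF b) by apply: map_basis => //; apply: invertibleV.
  apply: (zdim_le_tangent_dim char0 bh ZP Zlt Zd (x := x)).
  - exists y; rewrite /cell_trace /= -map_cell_basis -act_flag_of -hFy actK //.
  - by rewrite cell_trace_act.
  - by rewrite cell_trace_act.
split=> //; exists (map_tuple g^-1%VF b), x, T; split.
- by apply: map_basis => //; apply: invertibleV.
- by rewrite -map_cell_basis -act_flag_of -gFx actK.
- by rewrite cell_trace_act.
- by rewrite dT.
Qed.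

End Component.
End Components.

(** * The dimension read off the Young diagram, and the conclusion *)

Lemma sumn_count2 (l : seq nat) : all (fun m => m <= 2)%N l ->
  sumn l = (count (fun m => 0 < m) l + count (fun m => 1 < m) l)%N.
Proof. by elim: l => //= m l IHl /andP[le_m2 /IHl ->]; lia. Qed.

Lemma young_diagram_dim (C : closedFieldType) (V : vectType C) (u : 'End(V))
    (lam : seq nat) (r s : nat) :
  young_diagram u lam -> column_lengths lam = [:: r; s] -> \dim {:V} = (r + s)%N.
Proof.
move=> [slam _ [w [bw _ _]]] cols.
have head2 : head 0%N lam = 2.
  by have := congr1 size cols; rewrite size_map size_iota.
move: cols; rewrite /column_lengths head2 => -[<- <-].
have le2 : all (fun m => m <= 2)%N lam.
  move: slam head2; case: (lam) => //= m l /(order_path_min (fun x y z h1 h2 => leq_trans h2 h1)).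
  by move=> al m2; rewrite m2 in al *; apply: sub_all al.
rewrite -sumn_count2 //; rewrite (@vector.size_basis _ _ _ _ (in_tuple _) bw) size_allpairs_dep.
congr sumn; rewrite -[RHS](mkseq_nth 0%N); apply: eq_map => i.
by rewrite size_iota.
Qed.

Theorem proposition2p1 (R : realType) (V : vectType R[i]) (n r s : nat)
    (u : 'End(V)) (lam : seq nat) (e : n.-tuple V)
    (dimV : \dim {:V} = n)
    (u_nilpotent : nilpotent_end u)
    (lamE : young_diagram u lam)
    (columns : column_lengths lam = [:: r; s])
    (s_gt0 : (1 <= s)%N) (le_s_r : (s <= r)%N)
    (e_basis : basis_of fullv e)
    (u_first : forall i, (i < r)%N -> u (nth 0 e i) = 0)
    (u_second : forall i, (r <= i)%N -> (i < n)%N ->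
                  u (nth 0 e i) = nth 0 e (i - r)) :
  (forall K : set (preflag V n),
     irreducible_component (springer_fiber n u) K -> K (flag_of e)) /\
  (forall K : set (preflag V n),
     irreducible_component (springer_fiber n u) K ->
     (nonsingular K <-> nonsingular_at K (flag_of e))).
Proof.
have nE : n = (r + s)%N by rewrite -dimV; apply: young_diagram_dim lamE columns.
have r_gt0 : (0 < r)%N by apply: leq_trans le_s_r.
have le_n2r : (n <= r + r)%N by rewrite nE leq_add2l.
have uU : represents e u (\matrix_(i, j) (val j == val i + r)%N%:R).
  move=> a; rewrite vec_map -vec_bas; congr (vec _ a); apply: eq_from_tnth => j.
  rewrite tnth_map tnth_bas (tnth_nth 0) /vec.
  under eq_bigr => i _ do rewrite !mxE.
  have [lt_jr|le_rj] := ltnP j r.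
    rewrite u_first // big1 // => i _.
    by rewrite (_ : (_ == _) = false) ?scale0r //; apply: ltn_eqF; rewrite ltn_addl.
  rewrite u_second //.
  have lt_jr : (j - r < n)%N by rewrite (leq_ltn_trans (leq_subr _ _)).
  rewrite (bigD1 (Ordinal lt_jr)) //= subnK // eqxx scale1r big1 ?addr0 ?(tnth_nth 0) //.
  move=> i ni; rewrite (_ : (_ == _) = false) ?scale0r //; apply/negbTE.
  by apply: contra ni => /eqP E; rewrite -val_eqE /= [nat_of_ord j]E addnK.
split=> K KX; first exact: (component_flag dimV e_basis r_gt0 le_n2r uU KX).
have Ke := component_flag dimV e_basis r_gt0 le_n2r uU KX.
split=> [/(_ _ Ke) //|].
apply: (nonsingular_component dimV e_basis r_gt0 le_n2r uU KX).
exact: Num.Theory.pchar_num.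
Qed.
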